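(* Consider the central game on the English board $H_E$. It starts from the position $H_E\setminus\{(0,0)\}$ (all holes filled except the centre). The goal is to reach the position $\{(0,0)\}$ (a single peg in the centre) by a sequence of jumps. In any such solution, no intermediate position (i.e., any position other than the initial and final ones) is invariant under the $180^\circ$ rotation $(x,y)\mapsto(-x,-y)$. Equivalently, no intermediate position has any of the symmetry types 1–5: square symmetry, $90^\circ$ rotational symmetry, symmetry under both diagonal reflections, symmetry under both orthogonal reflections, or $180^\circ$ rotational symmetry.
   Context: The English board is $H_E=\{(x,y)\in\mathbb{Z}^2: |x|\le 3,\ |y|\le 3,\ \min(|x|,|y|)\le 1\}$. A board position is a subset of $H_E$, namely the set of holes occupied by pegs. A jump: given $d\in\{(\pm1,0),(0,\pm1)\}$ and $p$ with $p,p+d,p+2d\in H_E$, $p,p+d\in b$ and $p+2d\notin b$, the jump replaces $b$ by $(b\setminus\{p,p+d\})\cup\{p+2d\}$. Orthogonal reflections are $(x,y)\mapsto(-x,y)$ and $(x,y)\mapsto(x,-y)$. Diagonal reflections are $(x,y)\mapsto(y,x)$ and $(x,y)\mapsto(-y,-x)$. *)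

(* Defs.v *)
From Stdlib Require Import ZArith Bool.
Open Scope Z_scope.

Definition inH (x y : Z) : bool :=
  (Z.abs x <=? 3) && (Z.abs y <=? 3) && (Z.min (Z.abs x) (Z.abs y) <=? 1).

(* A board position: the set of occupied holes, as a characteristic function. *)
Definition Position := Z -> Z -> bool.

Definition pos_eq (b c : Position) : Prop := forall x y, b x y = c x y.

Definition is_dir (dx dy : Z) : Prop :=
  (dx = 1 /\ dy = 0) \/ (dx = -1 /\ dy = 0) \/ (dx = 0 /\ dy = 1) \/ (dx = 0 /\ dy = -1).

Definition jump (b b' : Position) : Prop :=
  exists dx dy px py,
    is_dir dx dy /\
    inH px py = true /\ inH (px + dx) (py + dy) = true /\
    inH (px + 2 * dx) (py + 2 * dy) = true /\
    b px py = true /\ b (px + dx) (py + dy) = true /\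
    b (px + 2 * dx) (py + 2 * dy) = false /\
    forall x y,
      b' x y =
        if ((x =? px) && (y =? py)) || ((x =? px + dx) && (y =? py + dy)) then false
        else if (x =? px + 2 * dx) && (y =? py + 2 * dy) then true
        else b x y.

Definition start_pos : Position :=
  fun x y => inH x y && negb ((x =? 0) && (y =? 0)).
Definition final_pos : Position :=
  fun x y => (x =? 0) && (y =? 0).

Definition rot180_invariant (b : Position) : Prop :=
  forall x y, b (- x) (- y) = b x y.

(* Main.v *)
(** Undoing a jump is the same jump on the complementary position, so an
    intermediate position [t] of a solution and its complement are both
    reachable from the start. If [t] is invariant under the rotation, one of
    the two is not reachable, already for reasons of integer linear
    programming: a play whose first jump is [m] writes the difference of the
    start and its last position as [m] plus a nonnegative integer combination
    of the vectors of the 76 possible jumps, and the first jump can only land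
    in the centre. A weight vector on which no jump increases the weight (a
    "pagoda function") bounds such combinations; a jump that loses more weight
    than the difference does cannot occur in them; deleting the jumps excluded
    in this way makes further weight vectors usable; finally weights that every
    remaining jump preserves modulo 2 give parity obstructions. A certificate
    records such a chain of weight vectors, with an occasional case distinction
    on whether a given jump occurs. All 2^16 invariant positions with an empty
    centre are covered by two global parities, nine pagoda functions, and 111
    certificates up to the symmetries of the board. *)

Require Import Defs.
From Stdlib Require Import ZArith Arith.
From Stdlib Require Import Lia Bool List MSetPositive.
Import ListNotations.
Open Scope Z_scope.

(** * Cells, weights and jumps *)

(* Reading order, so that the rotation by 180 degrees reverses the list and
   the centre is the cell number 16. *)
Definition cells : list (Z * Z) := Eval compute in
  filter (fun c => inH (fst c) (snd c))
    (flat_map (fun y => map (fun x => (x, y)) [-3; -2; -1; 0; 1; 2; 3])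
       [3; 2; 1; 0; -1; -2; -3]).

Definition at_cell (b : Position) (c : Z * Z) : bool := b (fst c) (snd c).

Definition enc (b : Position) : list bool := map (at_cell b) cells.

Fixpoint dot (q : list Z) (s : list bool) : Z :=
  match q, s with
  | a :: q', v :: s' => if v then a + dot q' s' else dot q' s'
  | _, _ => 0
  end.

Definition cell_eqb (c d : Z * Z) : bool :=
  (fst c =? fst d) && (snd c =? snd d).

Fixpoint index (c : Z * Z) (cs : list (Z * Z)) : nat :=
  match cs with
  | [] => 0%nat
  | d :: cs' => if cell_eqb c d then 0%nat else S (index c cs')
  end.

(* Source, jumped cell and landing cell, as positions in [cells]. *)
Definition move := (nat * nat * nat)%type.

(** A pagoda function is a [q] whose [loss] is nonnegative on every move. Missing entries count as
    weight 0, in agreement with [dot]. *)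
Definition loss (q : list Z) (m : move) : Z :=
  let '(i, j, k) := m in nth i q 0 + nth j q 0 - nth k q 0.

Definition dirs : list (Z * Z) := [(1, 0); (-1, 0); (0, 1); (0, -1)].

Definition moves_along (c d : Z * Z) : list move :=
  let over := (fst c + fst d, snd c + snd d) in
  let land := (fst c + 2 * fst d, snd c + 2 * snd d) in
  if inH (fst over) (snd over) && inH (fst land) (snd land)
  then [(index c cells, index over cells, index land cells)] else [].

Definition moves : list move := Eval compute in
  flat_map (fun c => flat_map (moves_along c) dirs) cells.

Definition total (q : list Z) (ms : list move) : Z :=
  fold_right (fun m t => loss q m + t) 0 ms.

Ltac find_in := repeat (first [left; reflexivity | right]).

Lemma cell_eqb_spec c d : reflect (c = d) (cell_eqb c d).
Proof.
  destruct c as [x y], d as [u v]; unfold cell_eqb; simpl.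
  destruct (Z.eqb_spec x u), (Z.eqb_spec y v); simpl; constructor; congruence.
Qed.

Lemma in_cells x y : inH x y = true -> In (x, y) cells.
Proof.
  intros H; assert (H' := H).
  unfold inH in H'; rewrite !andb_true_iff, !Z.leb_le in H'.
  assert (Hx : x = -3 \/ x = -2 \/ x = -1 \/ x = 0 \/ x = 1 \/ x = 2 \/ x = 3)
    by lia.
  assert (Hy : y = -3 \/ y = -2 \/ y = -1 \/ y = 0 \/ y = 1 \/ y = 2 \/ y = 3)
    by lia.
  clear H'.
  repeat (destruct Hx as [-> | Hx]); try subst x;
    repeat (destruct Hy as [-> | Hy]); try subst y;
    try discriminate H; find_in.
Qed.

Lemma cells_NoDup : NoDup cells.
Proof.
  unfold cells; repeat constructor; simpl; intuition discriminate.
Qed.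

(** By [NoDup] the altered cell occurs exactly once, so a single summand of [dot] changes; if [q] is
    too short to reach that cell, [nth] supplies the weight 0. *)
Lemma dot_update cs : forall q (f g : Z * Z -> bool) c,
  NoDup cs -> In c cs -> (forall d, d <> c -> g d = f d) ->
  dot q (map g cs) =
    dot q (map f cs) + nth (index c cs) q 0 * (Z.b2z (g c) - Z.b2z (f c)).
Proof.
  induction cs as [| d cs IH]; intros q f g c Hnd Hin Hoff; [destruct Hin |].
  inversion Hnd as [| ? ? Hd Hnd']; subst.
  destruct q as [| a q]; [simpl; destruct (cell_eqb c d); simpl; lia |].
  simpl; destruct (cell_eqb_spec c d) as [-> | Hne].
  - replace (map g cs) with (map f cs).
    + destruct (g d), (f d); simpl; lia.
    + apply map_ext_in; intros e He; symmetry; apply Hoff; congruence.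
  - destruct Hin as [-> | Hin]; [congruence |].
    rewrite (IH q f g c Hnd' Hin Hoff), (Hoff d) by congruence.
    destruct (f d); simpl; lia.
Qed.

Lemma nth_enc b x y v :
  inH x y = true -> nth (index (x, y) cells) (enc b) v = b x y.
Proof.
  intros H; apply in_cells in H; unfold enc.
  induction cells as [| d cs IH]; [destruct H |].
  simpl; destruct (cell_eqb_spec (x, y) d) as [<- | Hne]; [reflexivity |].
  destruct H as [-> | H]; [congruence | exact (IH H)].
Qed.

Lemma move_in x y dx dy :
  is_dir dx dy -> inH x y = true -> inH (x + dx) (y + dy) = true ->
  inH (x + 2 * dx) (y + 2 * dy) = true ->
  In (index (x, y) cells, index (x + dx, y + dy) cells,
      index (x + 2 * dx, y + 2 * dy) cells) moves.
Proof.
  intros Hd H1 H2 H3.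
  assert (E : moves = flat_map (fun c => flat_map (moves_along c) dirs) cells)
    by (vm_compute; reflexivity).
  rewrite E; clear E.
  apply in_flat_map; exists (x, y); split; [now apply in_cells |].
  apply in_flat_map; exists (dx, dy); split.
  - destruct Hd as [[-> ->] | [[-> ->] | [[-> ->] | [-> ->]]]]; find_in.
  - unfold moves_along; cbn [fst snd]; rewrite H2, H3; now left.
Qed.

(** This passes from jumps to linear algebra: for every weight the change depends only on the move.
    That the landing cell is empty is recorded as well, because it later singles out the possible
    first moves. *)
Lemma jump_loss b b' : jump b b' ->
  exists m, In m moves /\
    nth (snd m) (enc b) true = false /\
    forall q, dot q (enc b) = dot q (enc b') + loss q m.
Proof.
  intros (dx & dy & px & py & Hd & H1 & H2 & H3 & B1 & B2 & B3 & Hb').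
  exists (index (px, py) cells, index (px + dx, py + dy) cells,
          index (px + 2 * dx, py + 2 * dy) cells).
  split; [now apply move_in | split; [cbn [snd]; now rewrite nth_enc |]].
  intros q; cbn [loss].
  set (P := (px, py)); set (M := (px + dx, py + dy));
    set (L := (px + 2 * dx, py + 2 * dy)).
  assert (D : P <> M /\ P <> L /\ M <> L).
  { unfold P, M, L.
    destruct Hd as [[-> ->] | [[-> ->] | [[-> ->] | [-> ->]]]];
      repeat split; intros E; injection E; lia. }
  destruct D as (DPM & DPL & DML).
  (* The jump is split into three changes of one cell each: empty [P], empty [M], fill [L]. As the
     three cells are distinct, each still has its value from [b] when its turn comes. *)
  set (f0 := at_cell b).
  set (f1 := fun c => if cell_eqb c P then false else f0 c).
  set (f2 := fun c => if cell_eqb c M then false else f1 c).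
  set (f3 := fun c => if cell_eqb c L then true else f2 c).
  assert (E : enc b' = map f3 cells).
  { apply map_ext; intros [x y]; unfold at_cell; cbn [fst snd]; rewrite Hb'.
    change ((if cell_eqb (x, y) P || cell_eqb (x, y) M then false
             else if cell_eqb (x, y) L then true else f0 (x, y)) = f3 (x, y)).
    unfold f3, f2, f1.
    destruct (cell_eqb_spec (x, y) P), (cell_eqb_spec (x, y) M),
      (cell_eqb_spec (x, y) L); try reflexivity; congruence. }
  assert (S1 : forall c v (f : Z * Z -> bool) d, d <> c ->
            (if cell_eqb d c then v else f d) = f d)
    by (intros c v f d Hdc; destruct (cell_eqb_spec d c); congruence).
  assert (S0 : forall c, cell_eqb c c = true)
    by (intros c; destruct (cell_eqb_spec c c); congruence).
  assert (V0 : f0 P = true) by exact B1.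
  assert (V1 : f1 M = true) by (unfold f1; rewrite S1 by congruence; exact B2).
  assert (V2 : f2 L = false)
    by (unfold f2, f1; rewrite !S1 by congruence; exact B3).
  assert (W1 : f1 P = false) by (unfold f1; now rewrite S0).
  assert (W2 : f2 M = false) by (unfold f2; now rewrite S0).
  assert (W3 : f3 L = true) by (unfold f3; now rewrite S0).
  rewrite E.
  rewrite (dot_update cells q f2 f3 L cells_NoDup (in_cells _ _ H3)
             (S1 L true f2)).
  rewrite (dot_update cells q f1 f2 M cells_NoDup (in_cells _ _ H2)
             (S1 M false f1)).
  rewrite (dot_update cells q f0 f1 P cells_NoDup (in_cells _ _ H1)
             (S1 P false f0)).
  rewrite V0, V1, V2, W1, W2, W3.
  unfold enc; fold f0; cbn [Z.b2z]; lia.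
Qed.

(** * Plays *)

(** Positions are functions, so the reflexive case allows pointwise equality; this avoids functional
    extensionality. *)
Inductive play : Position -> Position -> Prop :=
| play_refl b c : pos_eq b c -> play b c
| play_step b c d : jump b c -> play c d -> play b d.

Lemma enc_ext b c : pos_eq b c -> enc b = enc c.
Proof. intros H; apply map_ext; intros [x y]; apply H. Qed.

Lemma jump_ext a b c : pos_eq a b -> jump b c -> jump a c.
Proof.
  intros E (dx & dy & px & py & Hd & H1 & H2 & H3 & B1 & B2 & B3 & Hb').
  exists dx, dy, px, py; rewrite !E; repeat (split; [assumption |]).
  intros x y; rewrite Hb', E; reflexivity.
Qed.

Lemma play_ext a b c : pos_eq a b -> play b c -> play a c.
Proof.
  intros E H; destruct H as [b c H | b c d H H'].
  - apply play_refl; intros x y; now rewrite E, H.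
  - apply (play_step a c d); [now apply (jump_ext a b c) | exact H'].
Qed.

Lemma play_snoc a b c : play a b -> jump b c -> play a c.
Proof.
  induction 1 as [a b E | a b d H _ IH]; intros J.
  - apply (play_step a c c); [now apply (jump_ext a b c) | now apply play_refl].
  - apply (play_step a b c); auto.
Qed.

(** The losses telescope along the play. Only the multiset of moves matters for the sum, so [ms]
    amounts to a nonnegative integer combination of move vectors, and one [ms] serves all
    weights. *)
Lemma play_losses b c : play b c ->
  exists ms, incl ms moves /\
    forall q, dot q (enc b) = dot q (enc c) + total q ms.
Proof.
  induction 1 as [b c E | b c d J _ (ms & Hms & IH)].
  - exists []; split; [intros m [] |].
    intros q; rewrite (enc_ext b c E); simpl; lia.
  - destruct (jump_loss b c J) as (m & Hm & _ & Hq).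
    exists (m :: ms); split; [now apply incl_cons |].
    intros q; rewrite Hq, IH; simpl; lia.
Qed.

(** * Symmetries *)

Definition flip (b : Position) : Position := fun x y => b (- x) y.
Definition transpose (b : Position) : Position := fun x y => b y x.
Definition rotate (b : Position) : Position := fun x y => b (- x) (- y).

Lemma inH_opp x y : inH (- x) (- y) = inH x y.
Proof. unfold inH; now rewrite !Z.abs_opp. Qed.

Lemma inH_comm x y : inH y x = inH x y.
Proof.
  unfold inH; rewrite Z.min_comm.
  now destruct (Z.abs x <=? 3), (Z.abs y <=? 3).
Qed.

Lemma opp_eqb x y : (- x =? y) = (x =? - y).
Proof. destruct (Z.eqb_spec (- x) y), (Z.eqb_spec x (- y)); lia. Qed.

Lemma jump_flip b c : jump b c -> jump (flip b) (flip c).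
Proof.
  intros (dx & dy & px & py & Hd & H1 & H2 & H3 & B1 & B2 & B3 & Hb').
  assert (HI : forall x y, inH (- x) y = inH x y)
    by (intros; unfold inH; now rewrite Z.abs_opp).
  exists (- dx), dy, (- px), py; unfold flip.
  replace (- px + - dx) with (- (px + dx)) by lia.
  replace (- px + 2 * - dx) with (- (px + 2 * dx)) by lia.
  rewrite !HI, !Z.opp_involutive.
  split; [unfold is_dir in *; lia |].
  repeat (split; [assumption |]).
  intros x y; rewrite Hb', !opp_eqb; reflexivity.
Qed.

Lemma jump_transpose b c : jump b c -> jump (transpose b) (transpose c).
Proof.
  intros (dx & dy & px & py & Hd & H1 & H2 & H3 & B1 & B2 & B3 & Hb').
  exists dy, dx, py, px; unfold transpose.
  rewrite (inH_comm px py), (inH_comm (px + dx)), (inH_comm (px + 2 * dx)).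
  split; [unfold is_dir in *; lia |].
  repeat (split; [assumption |]).
  intros x y; rewrite Hb'.
  now rewrite (andb_comm (x =? py)), (andb_comm (x =? py + dy)),
    (andb_comm (x =? py + 2 * dy)).
Qed.

Lemma play_flip b c : play b c -> play (flip b) (flip c).
Proof.
  induction 1 as [b c E | b c d J _ IH].
  - apply play_refl; intros x y; apply E.
  - exact (play_step _ _ _ (jump_flip _ _ J) IH).
Qed.

Lemma play_transpose b c : play b c -> play (transpose b) (transpose c).
Proof.
  induction 1 as [b c E | b c d J _ IH].
  - apply play_refl; intros x y; apply E.
  - exact (play_step _ _ _ (jump_transpose _ _ J) IH).
Qed.

Lemma play_rotate b c : play b c -> play (rotate b) (rotate c).
Proof.
  intros H.
  (* A transposition followed by a flip is a quarter turn; two quarter turns give [rotate] by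
     conversion. *)
  exact (play_flip _ _ (play_transpose _ _
           (play_flip _ _ (play_transpose _ _ H)))).
Qed.

(** * Complementation as time reversal, and the first jump *)

Definition complement (b : Position) : Position :=
  fun x y => inH x y && negb (b x y).

Lemma eqb2_spec x y p q : reflect (x = p /\ y = q) ((x =? p) && (y =? q)).
Proof.
  destruct (Z.eqb_spec x p), (Z.eqb_spec y q); simpl; constructor; tauto.
Qed.

(** After a jump its source and jumped cell are empty and its landing cell is filled. Exchanging
    pegs and holes turns this into the precondition of the very same jump, which then leads to the
    complement of the earlier position. *)
Lemma jump_complement b c : jump b c -> jump (complement c) (complement b).
Proof.
  intros (dx & dy & px & py & Hd & H1 & H2 & H3 & B1 & B2 & B3 & Hb').
  assert (D : ~ (px + 2 * dx = px /\ py + 2 * dy = py) /\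
              ~ (px + 2 * dx = px + dx /\ py + 2 * dy = py + dy))
    by (unfold is_dir in Hd; lia).
  assert (C1 : c px py = false) by (rewrite Hb', !Z.eqb_refl; reflexivity).
  assert (C2 : c (px + dx) (py + dy) = false)
    by (rewrite Hb', !Z.eqb_refl, orb_true_r; reflexivity).
  assert (C3 : c (px + 2 * dx) (py + 2 * dy) = true).
  { rewrite Hb', !Z.eqb_refl.
    destruct (eqb2_spec (px + 2 * dx) (py + 2 * dy) px py); [tauto |].
    destruct (eqb2_spec (px + 2 * dx) (py + 2 * dy) (px + dx) (py + dy));
      [tauto | reflexivity]. }
  exists dx, dy, px, py; unfold complement.
  rewrite C1, C2, C3, H1, H2, H3.
  repeat (split; [assumption || reflexivity |]).
  intros x y.
  destruct (eqb2_spec x y px py) as [[-> ->] | N1];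
    [now rewrite H1, B1 |].
  destruct (eqb2_spec x y (px + dx) (py + dy)) as [[-> ->] | N2];
    [now rewrite H2, B2 |].
  destruct (eqb2_spec x y (px + 2 * dx) (py + 2 * dy)) as [[-> ->] | N3];
    [now rewrite H3, B3 |].
  rewrite Hb'.
  destruct (eqb2_spec x y px py); [tauto |].
  destruct (eqb2_spec x y (px + dx) (py + dy)); [tauto |].
  destruct (eqb2_spec x y (px + 2 * dx) (py + 2 * dy)); [tauto | reflexivity].
Qed.

(* The position after the jump from (0, 2) to the centre. *)
Definition opening : Position := fun x y =>
  if ((x =? 0) && (y =? 2)) || ((x =? 0) && (y =? 1)) then false else inH x y.

Ltac compare_opening x y :=
  destruct (eqb2_spec x y 0 2) as [[-> ->] |]; [reflexivity |];
  destruct (eqb2_spec x y 0 1) as [[-> ->] |]; [reflexivity |];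
  destruct (eqb2_spec x y 0 0) as [[-> ->] |]; [reflexivity |];
  simpl; now rewrite andb_true_r.

(** The centre is the only hole without a peg, so the first jump lands there from one of four
    directions, and each direction is carried to [opening] by one of the listed symmetries. *)
Lemma first_jump b c : pos_eq b start_pos -> jump b c ->
  pos_eq c opening \/ pos_eq (rotate c) opening \/
  pos_eq (transpose c) opening \/ pos_eq (transpose (rotate c)) opening.
Proof.
  intros E (dx & dy & px & py & Hd & H1 & H2 & H3 & B1 & B2 & B3 & Hc).
  rewrite E in B3; unfold start_pos in B3; rewrite H3 in B3.
  destruct (eqb2_spec (px + 2 * dx) (py + 2 * dy) 0 0) as [[Ex Ey] |];
    [| discriminate B3].
  rewrite Ex, Ey in Hc; clear H1 H2 H3 B1 B2 B3.
  destruct Hd as [[-> ->] | [[-> ->] | [[-> ->] | [-> ->]]]].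
  - replace px with (-2) in Hc by lia; replace py with (0) in Hc by lia.
    assert (Hc' : forall x y, c x y =
      if ((x =? -2) && (y =? 0)) || ((x =? -1) && (y =? 0)) then false
      else if (x =? 0) && (y =? 0) then true else start_pos x y)
      by (intros x y; rewrite Hc, E; reflexivity).
    right; right; right; intros x y; unfold transpose, rotate, opening.
    rewrite Hc'; unfold start_pos.
    rewrite !opp_eqb, inH_opp; change (- (-2)) with 2.
    change (- (-1)) with 1; change (- 0) with 0.
    rewrite inH_comm, !(andb_comm (y =? _)).
    compare_opening x y.
  - replace px with (2) in Hc by lia; replace py with (0) in Hc by lia.
    assert (Hc' : forall x y, c x y =
      if ((x =? 2) && (y =? 0)) || ((x =? 1) && (y =? 0)) then false
      else if (x =? 0) && (y =? 0) then true else start_pos x y)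
      by (intros x y; rewrite Hc, E; reflexivity).
    right; right; left; intros x y; unfold transpose, opening.
    rewrite Hc'; unfold start_pos.
    rewrite inH_comm, !(andb_comm (y =? _)).
    compare_opening x y.
  - replace px with (0) in Hc by lia; replace py with (-2) in Hc by lia.
    assert (Hc' : forall x y, c x y =
      if ((x =? 0) && (y =? -2)) || ((x =? 0) && (y =? -1)) then false
      else if (x =? 0) && (y =? 0) then true else start_pos x y)
      by (intros x y; rewrite Hc, E; reflexivity).
    right; left; intros x y; unfold rotate, opening.
    rewrite Hc'; unfold start_pos.
    rewrite !opp_eqb, inH_opp; change (- (-2)) with 2.
    change (- (-1)) with 1; change (- 0) with 0.
    compare_opening x y.
  - replace px with (0) in Hc by lia; replace py with (2) in Hc by lia.
    assert (Hc' : forall x y, c x y =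
      if ((x =? 0) && (y =? 2)) || ((x =? 0) && (y =? 1)) then false
      else if (x =? 0) && (y =? 0) then true else start_pos x y)
      by (intros x y; rewrite Hc, E; reflexivity).
    left; intros x y; unfold opening; rewrite Hc'; unfold start_pos.
    compare_opening x y.
Qed.

Lemma play_ext_r a b c : play a b -> pos_eq b c -> play a c.
Proof.
  induction 1 as [a b E | a b d J _ IH]; intros E'.
  - apply play_refl; intros x y; now rewrite E.
  - exact (play_step a b c J (IH E')).
Qed.

(** Rotating a whole play does not change its invariant end [t], so openings that differ by the half
    turn are interchangeable. Of the four openings only two remain, and a transposition exchanges
    them. *)
Lemma play_start t : rot180_invariant t -> play start_pos t ->
  pos_eq t start_pos \/ play opening t \/ play opening (transpose t).
Proof.
  intros R P; inversion P as [? ? E | ? c ? J P']; subst.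
  - left; intros x y; symmetry; apply E.
  - right.
    assert (Rt : pos_eq (rotate t) t) by exact R.
    assert (O : forall d, pos_eq d opening -> pos_eq opening d)
      by (intros d H x y; symmetry; apply H).
    destruct (first_jump start_pos c) as [E | [E | [E | E]]];
      try (intros x y; reflexivity); try exact J.
    + left; apply (play_ext opening c); auto.
    + left; apply (play_ext_r _ (rotate t)); [| exact Rt].
      apply (play_ext _ (rotate c)); [now apply O |].
      now apply play_rotate.
    + right; apply (play_ext opening (transpose c)); [now apply O |].
      now apply play_transpose.
    + right; apply (play_ext_r _ (transpose (rotate t)));
        [| intros x y; apply Rt].
      apply (play_ext _ (transpose (rotate c))); [now apply O |].
      now apply play_transpose, play_rotate.
Qed.

Definition first_moves : list move := Eval compute in
  filter (fun m => negb (nth (snd m) (enc start_pos) true)) moves.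

(** The first move is kept apart from the others because it is known to be one of the few in
    [first_moves]; its guaranteed loss sharpens the pagoda bounds. *)
Lemma play_start_losses t : play start_pos t ->
  pos_eq t start_pos \/
  exists m ms, In m first_moves /\ incl ms moves /\
    forall q, dot q (enc start_pos) = dot q (enc t) + loss q m + total q ms.
Proof.
  intros P; inversion P as [? ? E | ? c ? J P']; subst.
  - left; intros x y; symmetry; apply E.
  - right; destruct (jump_loss _ _ J) as (m & Hm & Hf & Hq).
    destruct (play_losses _ _ P') as (ms & Hms & Hq').
    exists m, ms; split; [| split; [exact Hms |]].
    + change first_moves with
        (filter (fun m => negb (nth (snd m) (enc start_pos) true)) moves).
      apply filter_In; now rewrite Hf.
    + intros q; rewrite Hq, Hq'; lia.
Qed.

(** * Integer infeasibility certificates *)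

(** The numbers [v] select a weight vector. [Neg] closes a case when the moves cannot lose a
    negative amount, [Odd] when they cannot lose an odd one. [Cut] discards each move that alone
    would lose too much, and [Branch] distinguishes whether [m] occurs. *)
Inductive cert :=
| Neg (v : nat)
| Odd (v : nat)
| Cut (v : nat) (c : cert)
| Branch (m : move) (unused used : cert).

Definition move_eqb (m n : move) : bool :=
  let '(i, j, k) := m in let '(i', j', k') := n in
  ((i =? i') && (j =? j') && (k =? k'))%nat.

Lemma move_eqb_spec m n : reflect (m = n) (move_eqb m n).
Proof.
  destruct m as [[i j] k], n as [[i' j'] k']; simpl.
  destruct (Nat.eqb_spec i i'), (Nat.eqb_spec j j'), (Nat.eqb_spec k k');
    simpl; constructor; congruence.
Qed.

Definition displacement (source : list bool) (used : list move)
    (s : list bool) (q : list Z) : Z :=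
  dot q source - dot q s - total q used.

(* [allowed] contains every move that may still occur, [used] moves that are
   known to occur. *)
Fixpoint refutes (vectors : list (list Z)) (source : list bool) (c : cert)
    (allowed used : list move) (s : list bool) : bool :=
  match c with
  | Neg v => let q := nth v vectors [] in
      forallb (fun m => 0 <=? loss q m) allowed &&
      (displacement source used s q <? 0)
  | Odd v => let q := nth v vectors [] in
      forallb (fun m => Z.even (loss q m)) allowed &&
      Z.odd (displacement source used s q)
  | Cut v c' => let q := nth v vectors [] in
      let d := displacement source used s q in
      forallb (fun m => 0 <=? loss q m) allowed &&
      refutes vectors source c' (filter (fun m => loss q m <=? d) allowed) used s
  | Branch m c1 c2 =>
      refutes vectors source c1 (filter (fun n => negb (move_eqb m n)) allowed)
        used s &&
      refutes vectors source c2 allowed (m :: used) s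
  end.

Lemma total_nonneg q A ms :
  forallb (fun m => 0 <=? loss q m) A = true -> incl ms A -> 0 <= total q ms.
Proof.
  rewrite forallb_forall; intros H; induction ms as [| m ms IH]; intros I;
    simpl; [lia |].
  apply incl_cons_inv in I as [I1 I2].
  specialize (H m I1); rewrite Z.leb_le in H; specialize (IH I2); lia.
Qed.

Lemma total_even q A ms :
  forallb (fun m => Z.even (loss q m)) A = true -> incl ms A ->
  Z.even (total q ms) = true.
Proof.
  rewrite forallb_forall; intros H; induction ms as [| m ms IH]; intros I;
    simpl; [reflexivity |].
  apply incl_cons_inv in I as [I1 I2].
  now rewrite Z.even_add, (H m I1), (IH I2).
Qed.

Lemma total_app q ms ns : total q (ms ++ ns) = total q ms + total q ns.
Proof. induction ms as [| m ms IH]; simpl; lia. Qed.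

(** The equation is assumed for every weight list, so no condition on the vectors or on the range of
    their indices is needed. *)
Lemma refutes_sound vectors source c : forall allowed used s,
  refutes vectors source c allowed used s = true ->
  forall ms, incl ms allowed ->
  (forall q, total q ms = displacement source used s q) -> False.
Proof.
  induction c as [v | v | v c IH | m c1 IH1 c2 IH2];
    intros allowed used s H ms Hms Ht; simpl in H;
    apply andb_true_iff in H as [Ha Hb].
  - pose proof (total_nonneg _ _ _ Ha Hms) as Hn.
    rewrite Ht in Hn; apply Z.ltb_lt in Hb; lia.
  - pose proof (total_even _ _ _ Ha Hms) as Hn.
    rewrite Ht, <- Z.negb_odd, Hb in Hn; discriminate.
  (* For [Cut], the moves before and after an occurrence of [m] have nonnegative total loss, so the
     loss of [m] is at most the whole displacement and [m] survives the filter. *)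
  - refine (IH _ _ _ Hb ms _ Ht).
    intros m Hm; apply filter_In; split; [now apply Hms |].
    apply Z.leb_le; rewrite <- Ht.
    destruct (in_split _ _ Hm) as (l1 & l2 & ->).
    apply incl_app_inv in Hms as [I1 I2]; apply incl_cons_inv in I2 as [_ I2].
    pose proof (total_nonneg _ _ _ Ha I1); pose proof (total_nonneg _ _ _ Ha I2).
    rewrite total_app; simpl; lia.
  - destruct (existsb (move_eqb m) ms) eqn:E.
    + apply existsb_exists in E as (n & Hn & E).
      destruct (move_eqb_spec m n) as [<- |]; [clear E | discriminate].
      (* One occurrence of [m] is transferred from the unknown list to [used]. Further occurrences
         may remain, which is why [allowed] still contains [m]. *)
      destruct (in_split _ _ Hn) as (l1 & l2 & ->).
      apply incl_app_inv in Hms as [I1 I2]; apply incl_cons_inv in I2 as [_ I2].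
      apply (IH2 _ _ _ Hb (l1 ++ l2)); [now apply incl_app |].
      intros q; specialize (Ht q); rewrite total_app in *.
      unfold displacement in *; simpl in *; lia.
    + refine (IH1 _ _ _ Ha ms _ Ht).
      intros n Hn; apply filter_In; split; [now apply Hms |].
      destruct (move_eqb m n) eqn:E'; [| reflexivity].
      exfalso; apply not_true_iff_false in E; apply E.
      apply existsb_exists; now exists n.
Qed.

(** * Invariant positions *)

(* An invariant position is determined by its first 17 cells, the last of
   which is the centre. *)
Definition half (b : Position) : list bool := map (at_cell b) (firstn 17 cells).

(** The rotation reverses the reading order, so the code of an invariant position is a palindrome
    with the centre in the middle, taken only once. The type is generic because symmetric weights
    are built in the same way. *)
Definition unfold_half {A} (s : list A) : list A := s ++ rev (firstn 16 s).

(** The rotation exchanges the cells numbered [i] and [32 - i]; the smaller number represents the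
    pair and lies in the first half of the board. *)
Definition orbit (c : Z * Z) : nat :=
  Nat.min (index c cells) (32 - index c cells).

Definition permute (p : list nat) (s : list bool) : list bool :=
  map (fun i => nth i s false) p.

Definition flip_order : list nat := Eval compute in
  map (fun c => orbit (- fst c, snd c)) (firstn 17 cells).

Definition transpose_order : list nat := Eval compute in
  map (fun c => orbit (snd c, fst c)) (firstn 17 cells).

(** Corresponding entries of two explicit lists are either the same cell or opposite cells, where
    invariance [R] applies in one direction or the other. *)
Ltac same_cells R :=
  repeat (apply f_equal2; [first [reflexivity |
    match goal with
    | |- ?b _ _ = ?b ?x ?y => exact (R x y)
    end |
    match goal with
    | |- ?b ?x ?y = ?b _ _ => exact (eq_sym (R x y))
    end] |]); reflexivity.

Lemma enc_half b : rot180_invariant b -> enc b = unfold_half (half b).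
Proof.
  intros R; unfold enc, half, unfold_half, at_cell.
  cbn -[Z.opp]; same_cells R.
Qed.

Lemma half_flip b : rot180_invariant b ->
  half (flip b) = permute flip_order (half b).
Proof.
  intros R; unfold half, permute, at_cell, flip; cbn; same_cells R.
Qed.

Lemma half_transpose b : rot180_invariant b ->
  half (transpose b) = permute transpose_order (half b).
Proof.
  intros R; unfold half, permute, at_cell, transpose; cbn; same_cells R.
Qed.

Lemma half_length b : length (half b) = 17%nat.
Proof. reflexivity. Qed.

Lemma flip_invariant b : rot180_invariant b -> rot180_invariant (flip b).
Proof. intros R x y; apply (R (- x) y). Qed.

Lemma transpose_invariant b :
  rot180_invariant b -> rot180_invariant (transpose b).
Proof. intros R x y; apply R. Qed.

(** * Weights folded onto half of the board *)

Fixpoint add_lists (u v : list Z) : list Z :=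
  match u, v with
  | a :: u', b :: v' => (a + b) :: add_lists u' v'
  | [], _ => v
  | _, [] => u
  end.

(** Opposite cells of an invariant position are filled together, so their weights can be added. The
    first 17 entries include the centre, which has no partner; the other 16 are reversed to meet
    their opposites. *)
Definition fold_weights (q : list Z) : list Z :=
  add_lists (firstn 17 q) (rev (skipn 17 q)).

Lemma dot_app u : forall s v t, length u = length s ->
  dot (u ++ v) (s ++ t) = dot u s + dot v t.
Proof.
  induction u as [| a u IH]; intros [| x s] v t H; try discriminate H;
    [reflexivity |].
  injection H as H; simpl; rewrite (IH s v t H); destruct x; lia.
Qed.

Lemma dot_rev u : forall s, length u = length s -> dot (rev u) (rev s) = dot u s.
Proof.
  induction u as [| a u IH]; intros [| x s] H; try discriminate H; [reflexivity |].
  injection H as H; simpl rev; rewrite dot_app by now rewrite !length_rev.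
  rewrite (IH s H); simpl; destruct x; lia.
Qed.

Lemma dot_add_lists u : forall v s, dot (add_lists u v) s = dot u s + dot v s.
Proof.
  induction u as [| a u IH]; intros [| b v] [| x s]; simpl; try lia.
  rewrite IH; destruct x; lia.
Qed.

Lemma dot_firstn n : forall u s, (length u <= n)%nat -> dot u (firstn n s) = dot u s.
Proof.
  induction n as [| n IH]; intros [| a u] [| x s] H; simpl in *; try lia.
  now rewrite IH by lia.
Qed.

Lemma dot_fold_weights q s : length q = 33%nat -> length s = 17%nat ->
  dot q (unfold_half s) = dot (fold_weights q) s.
Proof.
  intros Hq Hs; unfold unfold_half, fold_weights.
  rewrite <- (firstn_skipn 17 q) at 1.
  rewrite dot_app, dot_add_lists by (rewrite length_firstn; lia).
  rewrite <- (rev_involutive (skipn 17 q)) at 1.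
  rewrite dot_rev by (rewrite length_rev, length_skipn, length_firstn; lia).
  rewrite dot_firstn by (rewrite length_rev, length_skipn; lia); reflexivity.
Qed.

Lemma dot_negb q : forall s,
  dot q (map negb s) = dot q (repeat true (length s)) - dot q s.
Proof.
  induction q as [| a q IH]; intros [| x s]; simpl; try lia.
  rewrite IH; destruct x; simpl; lia.
Qed.

(** * Bit lists as keys, and exhaustive enumeration *)

Fixpoint key (s : list bool) : positive :=
  match s with
  | [] => xH
  | v :: s' => if v then xI (key s') else xO (key s')
  end.

Fixpoint bits (p : positive) : list bool :=
  match p with
  | xH => []
  | xO p' => false :: bits p'
  | xI p' => true :: bits p'
  end.

(** The closing [xH] marks the end of the list, so leading and trailing [false] entries are not lost
    and the key determines the list. *)
Lemma bits_key s : bits (key s) = s.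
Proof. induction s as [| [] s IH]; simpl; congruence. Qed.

Fixpoint all_lists (n : nat) (P : list bool -> bool) : bool :=
  match n with
  | O => P []
  | S n' => all_lists n' (fun l => P (true :: l)) &&
            all_lists n' (fun l => P (false :: l))
  end.

Lemma all_lists_spec n : forall P, all_lists n P = true ->
  forall l, length l = n -> P l = true.
Proof.
  induction n as [| n IH]; intros P H [| x l] Hl; try discriminate Hl;
    [exact H |].
  simpl in H; apply andb_true_iff in H as [H1 H2]; injection Hl as Hl.
  destruct x; [exact (IH _ H1 l Hl) | exact (IH _ H2 l Hl)].
Qed.

(** * The certificates *)

(* These vectors and certificates were found by linear programming; only their
   validity matters. *)
Definition root_weights : list (list Z) := [
  [-1; 0; -1; 1; 1; 1; -1; 1; 0; 1; 0; 1; -1; 0; 1; 1; 0];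
  [0; 0; 0; 0; 1; 0; 0; 0; 0; 0; 0; 0; 0; 0; 1; 0; 1];
  [-1; 0; -1; 1; 1; 1; 0; 0; 0; 0; 0; 0; 0; 1; 0; 1; 1];
  [0; 1; 0; 0; 0; 0; -1; 1; 0; 1; 0; 1; -1; 0; 1; 0; 1];
  [-1; 1; -1; 1; 0; 1; -1; 1; 0; 1; 0; 1; -1; 1; 0; 1; 0];
  [-1; 0; -1; 1; 0; 1; 0; 0; 0; 0; 0; 0; 0; 0; 1; 1; 0];
  [0; 0; 0; 0; 1; 0; -1; 1; 0; 1; 0; 1; -1; 0; 0; 0; 0];
  [-1; 0; -1; 1; 1; 1; -1; 1; 0; 1; 0; 1; -1; 1; 0; 1; 0];
  [-1; 1; -1; 1; 0; 1; -1; 1; 0; 1; 0; 1; -1; 0; 1; 1; 0]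
].

Definition vectors : list (list Z) := [
  [0; 0; 0; 0; 3; 0; -2; 2; 0; 2; 0; 2; -2; 1; 1; 0; 1; 0; 1; 1; -1; 1; 0; 1;
  0; 1; -1; 0; 1; 0; 0; 0; 0];
  [-2; 0; -2; 2; 8; 3; -2; 4; 0; 4; 1; 3; -2; 0; 2; 2; 4; 2; 2; 0; -2; 2; 0; 2;
  0; 2; -2; 2; 2; 2; -2; 0; -2];
  [-6; 0; -6; 6; 5; 9; -3; 3; 0; 3; 3; 0; 3; 4; 3; 6; 2; 6; 1; 5; 1; 0; 1; 1;
  0; 1; -1; 7; 1; 6; -6; 0; -6];
  [-6; 0; -6; 9; 5; 6; 3; 0; 3; 3; 0; 3; -3; 5; 1; 6; 2; 6; 3; 4; -1; 1; 0; 1;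
  1; 0; 1; 6; 1; 7; -6; 0; -6];
  [0; 0; 0; 0; 1; 0; -1; 1; 0; 1; 0; 1; -1; 0; 0; 0; 0; 0; 0; 0; -1; 1; 0; 1;
  0; 1; -1; 0; 0; 0; 0; 1; 0];
  [-1; 0; -1; 1; 0; 1; 0; 0; 0; 0; 0; 0; 0; 0; 1; 1; 0; 1; 1; 0; 0; 0; 0; 0; 0;
  0; 0; 1; 0; 1; -1; 0; -1];
  [0; 0; 0; 0; 0; 1; 0; 0; 0; 0; 1; 1; 0; 0; 0; 0; 0; 0; 0; 0; 0; 0; 0; 0; 0;
  0; 0; 0; 0; 0; 0; 0; 0];
  [-4; 1; -3; 4; 8; 3; -2; 2; 0; 2; 0; 2; 0; 2; 2; 4; 6; 3; 3; 0; 0; 0; 0; 0;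
  0; 0; 0; 4; 6; 3; -4; 1; -3];
  [-2; 0; -2; 3; 8; 2; -2; 3; 1; 4; 0; 4; -2; 0; 2; 2; 4; 2; 2; 0; -2; 2; 0; 2;
  0; 2; -2; 2; 2; 2; -2; 0; -2];
  [-3; 0; -3; 3; 3; 6; -3; 3; 0; 3; 3; 6; -3; 2; 2; 3; 2; 3; 5; -2; -1; 1; 0;
  1; 0; 1; -1; 3; 1; 3; -3; 0; -3];
  [-1; 0; -1; 1; 3; 2; -2; 2; 0; 2; 1; 1; 0; 1; 0; 1; 1; 1; 0; 1; -1; 2; 1; 1;
  0; 1; -1; 2; 1; 1; -1; 0; -1];
  [0; 1; 1; 0; 4; 0; 0; 2; 0; 2; 1; 1; 0; 0; 2; 0; 2; 1; 1; 0; 0; 0; 0; 0; 0;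
  0; 0; 0; 2; 1; 0; 1; -1];
  [-3; 0; -3; 3; 11; 3; -7; 7; 0; 7; 0; 7; -3; 6; 7; 3; 4; 3; 7; 0; -1; 2; 1;
  3; 0; 3; -3; 2; 1; 3; -1; 2; -3];
  [0; 0; 0; 0; 1; 1; 1; 1; 0; 1; 1; 0; 1; 1; 1; 0; 0; 0; 1; 1; 0; 0; 0; 0; 0;
  0; 0; 0; 0; 0; 0; 0; 0];
  [-7; 0; -7; 14; 44; 10; -30; 37; 7; 44; 3; 41; -38; 4; 4; 7; 11; 13; 8; 5;
  -33; 40; 7; 33; 0; 33; -33; 0; 13; 13; 7; 20; -13];
  [0; 0; 0; 0; 0; 0; 0; 0; 0; 0; 0; 0; 0; -1; 0; 0; 0; 0; 0; -1; -1; 1; 0; 1;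
  0; 1; -1; 0; 2; 0; 0; -1; 0];
  [-1; 0; -1; 1; 0; 1; 0; 0; 0; 0; 0; 0; 1; 0; 1; 1; 0; 1; -1; 2; 0; 0; 0; 0;
  0; 0; 0; 1; 0; 1; -1; 0; -1];
  [-1; 0; -1; 1; 1; 1; -1; 1; 0; 1; 0; 1; -1; -1; 2; 1; 1; 1; 2; 1; 0; 0; 0; 0;
  0; 0; 0; 1; 1; 1; -1; 0; -1];
  [-3; 0; -3; 3; 3; 5; 1; 3; 0; 3; 2; 1; 1; 0; 3; 3; 2; 3; 3; 0; 1; 0; 1; 1; 0;
  1; 1; 4; 1; 3; -3; 0; -3];
  [-1; 0; -1; 1; 1; 1; -1; 1; 0; 1; 0; 1; -1; 1; 2; 1; 1; 1; 2; -1; 0; 0; 0; 0;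
  0; 0; 0; 1; 1; 1; -1; 0; -1];
  [-3; 0; -3; 3; 3; 3; -3; 3; 0; 3; 0; 3; -3; 0; 3; 3; 0; 3; 3; 0; -3; 4; 1; 3;
  0; 3; -3; 2; 1; 3; -1; 2; -3];
  [-1; 0; -1; 1; 0; 1; 1; 0; 0; 0; 0; 0; 0; 2; -1; 1; 0; 1; 1; 0; 0; 0; 0; 0;
  0; 0; 0; 1; 0; 1; -1; 0; -1];
  [-3; 1; -4; 3; 8; 4; 0; 2; 0; 2; 0; 2; -2; 0; 3; 3; 6; 4; 2; 2; 0; 0; 0; 0;
  0; 0; 0; 3; 6; 4; -3; 1; -4];
  [0; 0; 0; 0; 1; 1; 0; 0; 0; 0; 1; 1; 0; 1; 1; 0; 1; 0; 1; 1; 1; 1; 0; 1; 1;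
  0; 1; 0; 0; 1; 0; 0; 0];
  [-3; 0; -3; 3; 3; 3; -3; 3; 0; 3; 0; 3; -3; 0; 3; 3; 0; 3; 3; 0; -3; 3; 0; 3;
  1; 4; -3; 3; 1; 2; -3; 2; -1];
  [-3; 0; -3; 6; 3; 3; -3; 6; 3; 3; 0; 3; -3; -2; 5; 3; 2; 3; 2; 2; -1; 1; 0;
  1; 0; 1; -1; 3; 1; 3; -3; 0; -3];
  [-1; 0; -1; 1; 0; 1; 0; 0; 0; 0; 0; 0; 0; -1; -1; 1; 2; 1; 0; 1; -1; 1; 0; 1;
  0; 1; -1; 1; 1; 1; -1; 0; -1];
  [0; 0; 0; 1; 0; 0; 0; 1; 1; 0; 0; 0; 0; 0; 1; 0; 0; 0; 0; 0; 0; 0; 0; 0; 0;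
  0; 0; 0; 0; 0; 0; 0; 0];
  [-1; 5; 1; 1; 3; 0; -2; 2; 0; 2; 1; 1; 0; 1; 0; 1; 1; 1; 0; 1; -1; 2; 1; 1;
  0; 1; -1; 0; 1; 1; 1; 2; -1];
  [-1; 0; -1; 2; 3; 1; 0; 1; 1; 2; 0; 2; -2; 1; 0; 1; 1; 1; 0; 1; -1; 1; 0; 1;
  1; 2; -1; 1; 1; 2; -1; 0; -1];
  [0; 0; 0; 0; 0; 1; 0; 0; 0; 0; 1; 1; 0; 0; 0; 0; 0; 0; 1; 0; 0; 0; 0; 0; 0;
  0; 0; 0; 0; 0; 0; 0; 0];
  [0; 0; 0; 0; 0; 0; 0; 0; 0; 0; 0; 0; 0; 0; 0; 0; 0; 0; 0; 1; 0; 0; 0; 0; 0;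
  0; 0; 0; 0; 0; 0; 0; 0];
  [-2; 0; -2; 2; 3; 2; -2; 2; 0; 2; 0; 2; -2; 1; 1; 2; 1; 2; 1; 1; -1; 1; 0; 1;
  0; 1; -1; 2; 1; 2; -2; 0; -2];
  [-1; 0; -1; 1; 0; 0; 1; 0; 0; 0; -1; -1; 0; -1; 0; 1; 0; 1; 1; 0; 0; 0; 0; 0;
  0; 0; 0; 1; 0; 1; -1; 0; -1];
  [-1; 0; -1; 1; 2; -2; 0; 2; 0; 2; -3; -1; -1; -1; 2; 1; 2; 1; 1; 0; -1; 1; 0;
  1; 0; 1; -1; 1; 1; 1; -1; 0; -1];
  [-3; 0; -3; 5; 3; 3; 1; 1; 2; 3; 0; 3; 1; 0; 3; 3; 2; 3; 3; 0; 1; 1; 0; 1; 1;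
  0; 1; 3; 1; 4; -3; 0; -3];
  [-1; 0; -1; 1; 0; 1; 0; 0; 0; 0; 0; 0; 0; 1; 0; 1; 2; 1; -1; -1; -1; 1; 0; 1;
  0; 1; -1; 1; 1; 1; -1; 0; -1];
  [0; -1; -1; 0; 1; 1; 0; 0; 0; 0; 0; 0; 0; 0; 0; 0; 1; 1; 1; 0; 0; 0; 0; 0; 0;
  0; 0; 0; 1; 1; 0; 1; -1];
  [0; 0; 0; 0; 0; 1; 0; 0; 0; 0; 1; 1; 0; 0; 0; 0; 0; 0; 1; 1; 0; 0; 0; 0; 0;
  0; 0; 0; 0; 0; 0; 0; 0];
  [-3; 6; 3; 3; 5; 0; -3; 3; 0; 3; 3; 1; 2; 4; 3; 3; 2; 3; 0; 3; 1; 0; 1; 1; 0;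
  1; -1; 2; 1; 3; -1; 2; -3];
  [0; 0; 0; 0; 0; 0; 1; 0; 0; 0; 0; 0; 0; 1; 0; 0; 0; 0; 0; 0; 0; 0; 0; 0; 0;
  0; 0; 0; 0; 0; 0; 0; 0];
  [-3; 0; -3; 3; 11; 3; -3; 7; 0; 7; 0; 7; -7; 0; 7; 3; 4; 3; 7; 6; -3; 3; 0;
  3; 1; 2; -1; 3; 1; 2; -3; 2; -1];
  [-1; 0; -1; 1; 0; 0; 0; 0; 0; 0; -1; 1; -1; 0; 0; 1; 0; 1; 1; 0; 0; 0; 0; 0;
  0; 0; 0; 1; 0; 1; -1; 0; -1];
  [-1; 2; 1; 1; -1; 1; 0; 0; 0; 0; 0; 0; 0; 0; 1; 1; 0; 1; 1; 0; 0; 0; 0; 0; 0;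
  0; 0; 1; 0; 1; -1; 0; -1];
  [1; 1; 0; 0; 4; 0; 0; 1; 1; 2; 0; 2; 0; 0; 1; 1; 2; 0; 2; 0; 0; 0; 0; 0; 0;
  0; 0; 1; 2; 0; -1; 1; 0];
  [-3; 0; -3; 3; 3; 6; -3; 3; 0; 3; 3; 0; 3; -2; 5; 3; 2; 3; -1; 4; -1; 1; 0;
  1; 0; 1; 1; 3; 1; 3; -3; 0; -3];
  [-3; 0; -3; 6; 3; 3; 3; 0; 3; 3; 0; 3; -3; 4; -1; 3; 2; 3; 5; -2; 1; 1; 0; 1;
  0; 1; -1; 3; 1; 3; -3; 0; -3];
  [-1; 0; -1; -2; 2; 1; -1; -1; -3; 2; 0; 2; 0; 0; 1; 1; 2; 1; 2; -1; -1; 1; 0;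
  1; 0; 1; -1; 1; 1; 1; -1; 0; -1];
  [-2; 0; -2; 4; 9; 3; -4; 7; 2; 9; 1; 8; -4; 0; 4; 2; 5; 4; 5; 0; -4; 4; 0; 4;
  0; 4; -4; 2; 2; 4; -2; 2; -4];
  [-1; 0; -1; 0; 0; 1; 0; -1; -1; 0; 0; 0; 1; 0; 1; 1; 0; 1; 0; -1; 0; 0; 0; 0;
  0; 0; 0; 1; 0; 1; -1; 0; -1];
  [1; 2; -1; 1; -1; 1; 0; 0; 0; 0; 0; 0; 0; 0; 1; 1; 0; 1; 1; 0; 0; 0; 0; 0; 0;
  0; 0; 1; 0; 1; -1; 0; -1];
  [-2; 0; -2; 3; 9; 4; -4; 8; 1; 9; 2; 7; -4; 0; 5; 4; 5; 2; 4; 0; -4; 4; 0; 4;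
  0; 4; -4; 4; 2; 2; -4; 2; -2];
  [-2; 3; 1; 2; 2; 0; 1; 1; 0; 1; 1; 0; 1; 0; 2; 2; 1; 1; 1; 0; 1; 0; 1; 1; 0;
  1; 1; 1; 0; 1; 0; 1; -1];
  [-1; 0; -1; 0; 0; 1; -1; 1; -1; 0; 0; 0; 0; 0; 1; 1; 0; 1; 0; 0; 0; 0; 0; 0;
  0; 0; 0; 1; 0; 1; -1; 0; -1];
  [-1; 2; 1; 0; 1; -1; -1; 1; 0; 1; 0; 1; -1; 0; 0; 0; 0; -1; -1; 0; -1; 1; 0;
  1; 0; 1; -1; 0; -1; -1; 0; -1; 1];
  [0; 0; 0; 0; 0; 0; 0; 0; 0; 0; 0; 0; 1; 0; 0; 0; 0; 0; 0; 1; 0; 0; 0; 0; 0;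
  0; 0; 0; 0; 0; 0; 0; 0];
  [0; 0; 0; 0; 3; 0; -1; 2; 0; 2; 0; 2; -1; 0; 1; 0; 1; 0; 1; 0; -1; 1; 0; 1;
  0; 1; -1; 0; 1; 0; 0; 0; 0];
  [0; 0; 0; 1; 1; 1; 0; 0; 1; 1; 1; 0; 0; 0; 0; 0; 0; 0; 0; 0; 0; 0; 0; 0; 0;
  0; 0; 0; 0; 0; 0; 0; 0];
  [1; -1; 0; 1; 2; 0; -1; 1; 0; 1; 0; 1; -1; 0; 1; 1; 1; 0; 0; 0; -1; 1; 0; 1;
  0; 1; -1; 1; 0; 0; -1; -1; 0];
  [-1; -1; 0; 1; 1; 0; 0; 0; 0; 0; 0; 0; 0; 0; 1; 1; 1; 0; 0; 0; 0; 0; 0; 0; 0;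
  0; 0; 1; 1; 0; -1; 1; 0];
  [1; 2; -1; -1; 1; 0; -1; 1; 0; 1; 0; 1; -1; 0; -1; -1; 0; 0; 0; 0; -1; 1; 0;
  1; 0; 1; -1; -1; -1; 0; 1; -1; 0];
  [2; 0; 2; 0; 4; 2; 2; 0; 2; 2; 1; 3; -2; 3; 3; 2; 2; 2; 3; 4; -1; 2; 1; 1; 2;
  0; 2; 1; 1; 0; 2; 0; 2];
  [-2; 1; -1; 2; -1; 1; 0; 0; 0; 0; 0; 0; 0; -1; 3; 2; -1; 1; -1; -1; -1; 1; 0;
  1; 0; 1; -1; 2; -1; 1; -1; 0; -1];
  [-1; -1; 1; 1; 3; -1; -1; 1; 0; 1; 0; 1; -1; 0; 1; 1; 2; -1; -1; 0; -1; 1; 0;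
  1; 0; 1; -1; 1; 2; -1; -1; 2; 1];
  [0; 0; 0; 0; 0; 0; 0; 0; 0; 0; 0; 0; 0; 1; 0; 0; 0; 0; 0; 0; 0; 0; 0; 0; 0;
  0; 0; 0; 0; 0; 0; 0; 0];
  [-7; 0; -7; 10; 44; 14; -38; 41; 3; 44; 7; 37; -30; 5; 8; 13; 11; 7; 4; 4;
  -33; 33; 0; 33; 7; 40; -33; 13; 13; 0; -13; 20; 7];
  [-2; 3; 1; 2; 2; 0; -1; 1; 0; 1; 1; 2; -1; 0; 2; 2; 1; 1; 1; 0; -1; 2; 1; 1;
  0; 1; -1; 1; 0; 1; 0; 1; -1];
  [-1; 0; -1; 0; -1; 2; -1; 0; -1; -1; 1; 0; 1; 1; 0; 1; 0; 1; 1; 0; 0; 0; 0;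
  0; 0; 0; 0; 1; 0; 1; -1; 0; -1];
  [-1; 0; -1; 2; -1; 0; 1; 0; 1; -1; -1; 0; -1; 0; 1; 1; 0; 1; 0; 1; 0; 0; 0;
  0; 0; 0; 0; 1; 0; 1; -1; 0; -1];
  [-1; 1; -1; 1; 0; 1; 0; 0; 0; 0; 0; 0; 0; 0; 1; 1; 0; 1; 1; 0; 0; 0; 0; 0; 0;
  0; 0; 1; 0; 1; -1; 0; -1];
  [0; -1; 1; 0; 2; 1; -1; 1; 0; 1; 0; 1; -1; 0; 0; 0; 1; 1; 1; 0; -1; 1; 0; 1;
  0; 1; -1; 0; 0; 1; 0; -1; -1];
  [-1; 0; -1; 1; 3; 1; -1; 1; 0; 1; 0; 1; -1; 0; 1; 1; 2; 1; 1; 0; -1; 1; 0; 1;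
  0; 1; -1; 1; 1; 1; -1; 0; -1];
  [-1; 0; -1; 2; 3; 4; -1; 2; 1; 3; 3; 6; -1; 0; 1; 1; 2; 1; 1; 0; -1; 1; 0; 1;
  0; 1; -1; 1; 1; 1; -1; 0; -1];
  [-1; 2; 1; 1; 0; 1; 0; 0; 0; 0; 0; 0; 0; 0; 1; 1; 0; 1; 1; 0; 0; 0; 0; 0; 0;
  0; 0; 1; 0; 1; -1; 0; -1];
  [0; 0; 0; 0; 1; 1; 1; 1; 0; 1; 1; 0; 1; 1; 0; 0; 0; 0; 0; 1; 0; 0; 0; 0; 0;
  0; 0; 0; 0; 0; 0; 0; 0];
  [0; 0; 0; 1; 0; 0; 0; 1; 1; 0; 0; 0; 0; 0; 0; 0; 0; 0; 0; 0; 0; 0; 0; 0; 0;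
  0; 0; 0; 0; 0; 0; 0; 0];
  [1; 0; 1; -1; 0; -1; 0; 0; 0; 0; 0; 0; 0; -1; 0; -1; 2; -1; -2; 1; -1; 1; 0;
  1; 0; 1; -1; -1; 1; -1; 1; 0; 1];
  [1; 0; 1; -1; 0; -1; 0; 0; 0; 0; 0; 0; 0; 0; -1; -1; 0; -1; 1; 0; 0; 0; 0; 0;
  0; 0; 0; -1; 0; -1; 1; 0; 1];
  [1; 0; 1; 0; 3; 2; -1; 4; 1; 3; 1; 2; -1; 0; 3; 1; 2; 1; 1; 0; -1; 1; 0; 1;
  1; 2; -1; 1; 1; 0; 1; 0; 1];
  [1; 1; 2; 0; 1; 1; 1; 0; 1; 1; 1; 0; 1; 0; 0; 0; 0; 0; 0; 0; 1; 0; 1; 1; 1;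
  0; 1; 0; 0; 0; 1; 1; 1];
  [2; 0; 2; -2; 2; -2; -2; 2; 0; 2; 0; 2; -1; 3; -2; -2; 2; -2; -2; 0; 1; 1; 0;
  1; 0; 1; -1; -2; 1; -2; 2; 0; 2];
  [-3; 0; -3; 0; 3; 3; -9; 6; -3; 3; 0; 3; -3; 6; -3; 3; 2; 3; 6; -3; -1; 1; 0;
  1; 0; 1; -1; 3; 1; 3; -3; 0; -3];
  [-3; 0; -3; 3; 3; 6; -3; 3; 0; 3; 3; 0; -3; 6; -3; 3; 2; 3; 6; -3; -1; 1; 0;
  1; 0; 1; -1; 3; 1; 3; -3; 0; -3];
  [-3; 0; -3; 3; 3; 6; -3; 3; 0; 3; 3; 6; -3; 6; -3; 3; 2; 3; 5; -2; -1; 1; 0;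
  1; 0; 1; -1; 3; 1; 3; -3; 0; -3];
  [-3; 0; -3; 6; 3; 3; -3; 0; 3; 3; 0; 3; -3; -3; 6; 3; 2; 3; -3; 6; -1; 1; 0;
  1; 0; 1; -1; 3; 1; 3; -3; 0; -3];
  [-2; -2; -4; -2; -2; 4; 1; 7; 4; 4; 0; 4; -1; -2; 4; 2; 2; 4; -2; 0; -1; 1;
  0; 1; 1; 2; -1; 2; 1; 3; -2; 0; -2];
  [-2; -2; -4; 3; 5; 8; -1; 2; 1; 3; 4; 7; -1; 0; 6; 4; 2; 4; 6; 0; -1; 1; 0;
  1; 0; 1; -1; 4; 1; 4; -4; 0; -4];
  [-2; 0; -2; 2; 2; -2; -2; 2; 0; 2; -4; -2; -2; 4; -2; 2; 1; 2; 3; -1; -1; 1;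
  0; 1; 0; 1; -1; 2; 1; 2; -2; 0; -2];
  [-1; -1; -1; 1; -1; 0; -1; 1; 0; 1; -1; 0; -1; 0; 1; 1; 0; 1; 1; 0; -1; 1; 0;
  1; 0; 1; -1; 1; -1; 1; -1; -1; -1];
  [-1; -1; -1; 1; -1; 1; -1; 1; 0; 1; 0; 1; -1; 0; 1; 1; 0; 1; 1; 0; -1; 1; 0;
  1; 0; 1; -1; 1; -1; 1; -1; -1; -1];
  [-1; -1; -1; 1; -1; 2; -1; 1; 0; 1; 1; 2; -1; 0; 1; 1; 0; 1; 1; 0; -1; 1; 0;
  1; 0; 1; -1; 1; -1; 1; -1; -1; -1];
  [-1; 0; -1; -1; 0; 1; -1; 2; -2; 0; 0; 0; 0; -1; 2; 1; 0; 1; -1; 2; 0; 0; 0;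
  0; 0; 0; 0; 1; 0; 1; -1; 0; -1];
  [-1; 0; -1; 1; -1; 1; 0; 0; 0; 0; 0; 0; -1; 0; 1; 1; 0; 1; -1; 1; 0; 0; 0; 0;
  0; 0; 0; 1; 0; 1; -1; 0; -1];
  [-1; 0; -1; 1; -1; 1; 0; 0; 0; 0; 0; 0; 0; -1; 2; 1; 1; 1; -1; -1; -1; 1; 0;
  1; 0; 1; -1; 1; 1; 1; -1; 0; -1];
  [-1; 0; -1; 1; 0; -1; 0; 0; 0; 0; -2; 2; -1; 2; -1; 1; 0; 1; 2; -1; 0; 0; 0;
  0; 0; 0; 0; 1; 0; 1; -1; 0; -1];
  [-1; 0; -1; 1; 1; 0; -1; 1; 0; 1; -1; 0; -1; 0; 1; 1; 0; 1; 1; 0; -1; 1; 0;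
  1; 0; 1; -1; 1; 1; 1; -1; 0; -1];
  [-1; 0; -1; 1; 1; 1; 0; 0; 0; 0; 0; 0; 0; 0; 1; 1; 1; 1; 1; 0; 0; 0; 0; 0; 0;
  0; 0; 1; 0; 1; -1; 0; -1];
  [-1; 0; -1; 1; 1; 2; -1; 1; 0; 1; 1; 2; -1; 0; 1; 1; 0; 1; 1; 0; -1; 1; 0; 1;
  0; 1; -1; 1; 1; 1; -1; 0; -1];
  [-1; 0; -1; 1; 3; 2; -3; 3; 0; 3; 1; 2; -1; 2; -1; 1; 2; 1; 1; 0; -1; 1; 0;
  1; 0; 1; -1; 1; 1; 1; -1; 0; -1];
  [-1; 0; -1; 2; 3; 5; -1; 2; 1; 3; 4; 5; -1; 0; 1; 1; 2; 1; 1; 0; -1; 1; 0; 1;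
  0; 1; -1; 1; 1; 1; -1; 0; -1];
  [-1; 2; 1; -1; 3; -1; 0; 1; 1; 1; 0; 1; -1; -1; 1; -1; 2; -1; -1; 0; -1; 1;
  0; 1; 0; 1; -1; -1; 1; -1; 1; 0; 1];
  [0; 0; 0; 0; 0; 0; 1; 1; 0; 1; 0; 1; 0; 1; 1; 0; 1; 0; 0; 0; 0; 0; 0; 0; 0;
  0; 0; 0; 0; 0; 0; 0; 0];
  [0; 0; 0; 0; 0; 1; 1; 1; 0; 1; 1; 0; 1; 1; 1; 0; 1; 0; 0; 1; 0; 0; 0; 0; 0;
  0; 0; 0; 0; 0; 0; 0; 0];
  [0; 0; 0; 1; 4; 0; -2; 3; 1; 4; 0; 4; -2; 0; 2; 0; 2; 0; 2; 0; -2; 3; 1; 2;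
  0; 2; -2; 0; 1; 0; 1; 1; 0];
  [1; 0; 1; -1; 1; -1; -1; 1; 0; 1; 0; 1; -1; 0; -1; -1; 2; -1; -1; 0; -1; 2;
  1; 1; 0; 1; -1; 0; 1; -1; 1; 0; 1];
  [1; 0; 1; -1; 2; -1; 0; 0; 0; 0; 0; 0; -1; -1; 1; -1; 2; -1; -1; 0; -1; 1; 0;
  1; 0; 1; -1; -1; 1; -1; 1; 0; 1];
  [1; 2; -1; 1; 0; 1; 0; 0; 0; 0; 0; 0; 0; 0; 1; 1; 0; 1; 1; 0; 0; 0; 0; 0; 0;
  0; 0; 1; 0; 1; -1; 0; -1];
  [1; 3; -2; 0; 2; 2; 1; 0; 1; 1; 0; 1; 1; 0; 1; 1; 1; 2; 2; 0; 1; 1; 0; 1; 1;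
  0; 1; 1; 0; 1; -1; 1; 0];
  [1; 5; -1; 0; 3; 1; 0; 1; 1; 2; 0; 2; -2; 1; 0; 1; 1; 1; 0; 1; -1; 1; 0; 1;
  1; 2; -1; 1; 1; 0; -1; 2; 1];
  [3; 0; 3; 1; 3; -2; 5; -1; 4; 3; 1; 2; -1; -2; -1; -3; 2; -3; -2; -1; -1; 1;
  0; 1; 0; 1; -1; -3; 1; -3; 3; 0; 3]
].

(* A certificate is followed by the [key]s of the invariant positions that it
   excludes: cell 0 is the lowest bit and a leading 1 marks the end. *)
Definition table : list (cert * list positive) := [
  (Neg 0,
   [145310; 147614; 147984; 147986; 148188; 148190; 148252; 148254; 148916;
   148918; 149044; 149046; 149309; 149311; 149492; 149494; 149556; 149558;
   149821; 149823; 150004; 150006; 150132; 150134; 150544; 150546; 150748;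
   150750; 150812; 150814; 151388; 151390; 152222; 152464; 152466; 153277;
   153279; 153524; 153526; 153789; 153791; 154036; 154038; 154164; 154166;
   154365; 154367; 154429; 154431; 154612; 154614; 154780; 154782; 155024;
   155026; 155152; 155154; 155356; 155358; 155420; 155422; 155600; 155602;
   155709; 155711; 155804; 155806; 155892; 155894; 155956; 155958; 156176;
   156178; 156300; 156380; 156382; 156405; 156444; 156446; 156469; 156532;
   156534; 156702; 156720; 156722; 156924; 156926; 156944; 156946; 156988;
   156990; 157108; 157110; 157148; 157150; 157168; 157170; 157236; 157238;
   157278; 157296; 157298; 157501; 157503; 157564; 157566; 157604; 157684;
   157686; 157748; 157750; 157790; 157808; 157810; 157869; 158013; 158015;
   158076; 158078; 158116; 158196; 158198; 158244; 158324; 158326; 158509;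
   158692; 158736; 158738; 158860; 158940; 158942; 158965; 159004; 159006;
   159029; 159092; 159094; 159104; 159232; 159436; 159500; 159580; 159582;
   159605; 159607; 159926; 160189; 160191; 160317; 160319; 160412; 160414;
   160500; 160502; 160564; 160566; 160656; 160658; 160914; 160956; 160958;
   161180; 161182; 161200; 161202; 161308; 161310; 161328; 161330; 161430;
   161469; 161471; 161532; 161534; 161552; 161554; 161596; 161598; 161716;
   161718; 161756; 161758; 161776; 161778; 161822; 161840; 161842; 161981;
   161983; 162000; 162002; 162044; 162046; 162064; 162066; 162108; 162110;
   162228; 162230; 162268; 162270; 162288; 162290; 162356; 162358; 162398;
   162416; 162418; 162477; 162557; 162559; 162621; 162623; 162640; 162642;
   162684; 162686; 162724; 162804; 162806; 162877; 162879; 162972; 162974;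
   163060; 163062; 163124; 163126; 163216; 163218; 163325; 163327; 163344;
   163346; 163453; 163455; 163468; 163548; 163550; 163573; 163612; 163614;
   163637; 163700; 163702; 163712; 163792; 163794; 175989; 175991; 177814;
   180628; 180630; 180756; 180758; 181204; 181206; 181685; 181687; 181813;
   181815; 182261; 182263; 182325; 182327; 182773; 182775; 182901; 182903;
   183316; 183318; 183764; 183766; 183892; 183894; 185236; 185238; 186293;
   186295; 186805; 186807; 186933; 186935; 187381; 187383; 187796; 187798;
   187924; 187926; 188372; 188374; 188432; 188434; 188636; 188638; 188661;
   188663; 188700; 188702; 188725; 188727; 188820; 188822; 188948; 188950;
   189276; 189278; 189301; 189303; 189316; 189396; 189398; 189492; 189494;
   189652; 189654; 189716; 189718; 189757; 189759; 189877; 189879; 189940;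
   189942; 190005; 190007; 190068; 190070; 190229; 190292; 190294; 190373;
   190453; 190455; 190517; 190519; 190580; 190582; 190804; 190806; 190885;
   190965; 190967; 191013; 191093; 191095; 191461; 191508; 191510; 191836;
   191838; 191861; 191863; 191876; 191956; 191958; 192004; 192084; 192086;
   192452; 192668; 192670; 192693; 192695; 192912; 192914; 193040; 193042;
   193244; 193246; 193269; 193271; 193308; 193310; 193333; 193335; 193428;
   193430; 193684; 193686; 193725; 193727; 193972; 193974; 194100; 194102;
   194197; 194199; 194260; 194262; 194324; 194326; 194365; 194367; 194485;
   194487; 194548; 194550; 194612; 194614; 194772; 194774; 194813; 194815;
   194836; 194838; 194877; 194879; 194997; 194999; 195060; 195062; 195125;
   195127; 195188; 195190; 195285; 195349; 195412; 195414; 195453; 195455;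
   195493; 195573; 195575; 195600; 195602; 195804; 195806; 195829; 195831;
   195868; 195870; 195893; 195895; 195988; 195990; 196048; 196050; 196055;
   196116; 196118; 196176; 196178; 196444; 196446; 196469; 196471; 196484;
   196564; 196566; 196766; 196786; 197054; 197136; 197138; 197180; 197182;
   197340; 197342; 197362; 197404; 197406; 197424; 197426; 197630; 198068;
   198070; 198196; 198198; 198461; 198463; 198644; 198646; 198708; 198710;
   198973; 198975; 199156; 199158; 199284; 199286; 199696; 199698; 199742;
   199900; 199902; 199922; 199964; 199966; 199986; 200190; 200318; 200542;
   200562; 201374; 201394; 201616; 201618; 201662; 202941; 202943; 203188;
   203190; 203316; 203318; 203517; 203519; 203581; 203583; 203764; 203766;
   203934; 203954; 204176; 204178; 204222; 204304; 204306; 204350; 204508;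
   204510; 204530; 204572; 204574; 204594; 204752; 204754; 204798; 204958;
   205328; 205330; 206900; 206902; 207476; 207478; 207844; 207888; 207890;
   208094; 208158; 208588; 208652; 208732; 208734; 209564; 209566; 209808;
   209810; 210621; 210623; 210868; 210870; 211629; 211876; 212126; 212620;
   212702; 212766; 212864; 221344; 221612; 221696; 221740; 221900; 221920;
   221964; 221984; 222188; 222628; 222756; 223021; 223204; 223268; 223533;
   223716; 223844; 224256; 224300; 224460; 224480; 224524; 224544; 224748;
   224876; 225100; 225120; 225932; 225952; 226176; 226220; 226989; 227236;
   227501; 227748; 227876; 228077; 228141; 228324; 228492; 228512; 228736;
   228780; 228864; 228908; 229068; 229088; 229132; 229152; 229312; 229356;
   229556; 229558; 229780; 229782; 229908; 229910; 229949; 229951; 230134;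
   230196; 230198; 230356; 230358; 230814; 230837; 230839; 230940; 230942;
   230965; 230967; 231184; 231186; 231390; 231413; 231415; 231452; 231454;
   231477; 231479; 231696; 231698; 231902; 231925; 231927; 232030; 232053;
   232055; 232468; 232470; 232509; 232511; 232694; 232758; 232916; 232918;
   233044; 233046; 233332; 233334; 234166; 234388; 234390; 234429; 234431;
   235154; 235420; 235422; 235445; 235447; 235666; 235934; 235957; 235959;
   236062; 236085; 236087; 236242; 236306; 236510; 236533; 236535; 236726;
   236948; 236950; 236989; 236991; 237076; 237078; 237117; 237119; 237302;
   237366; 237524; 237526; 237565; 237567; 237972; 237974; 238100; 238102;
   239029; 239031; 239525; 239605; 239607; 239669; 239671; 240037; 240117;
   240119; 240245; 240247; 240613; 240660; 240662; 241028; 241110; 241156;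
   241236; 241238; 241604; 242580; 242582; 243637; 243639; 244149; 244151;
   244645; 244725; 244727; 245142; 245270; 245636; 245718; 254116; 254340;
   254468; 254509; 254692; 254756; 254916; 255372; 255397; 255500; 255525;
   255744; 255948; 255973; 256012; 256037; 256256; 256460; 256485; 256588;
   256613; 257028; 257069; 257252; 257316; 257476; 257604; 257892; 258724;
   258948; 258989; 259712; 259980; 260005; 260224; 260492; 260517; 260620;
   260645; 260800; 260864; 261068; 261093; 261284; 261508; 261549; 261636;
   261677; 261860; 261924; 262084; 262125]%positive);
  (Neg 1,
   [132284; 132286; 132528; 132530; 132656; 132658; 132860; 132862; 132924;
   132926; 133104; 133106; 133372; 133374; 133616; 133618; 134012; 134014;
   136378; 136892; 136894; 137018; 137136; 137138; 137404; 137406; 137466;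
   137648; 137650; 137776; 137778; 137980; 137982; 138044; 138046; 138106;
   138224; 138226; 148732; 148734; 148976; 148978; 149104; 149106; 149372;
   149374; 152764; 152766; 153008; 153010; 153136; 153138; 153340; 153342;
   153404; 153406; 153584; 153586; 153852; 153854; 154096; 154098; 154224;
   154226; 154492; 154494; 164572; 164574; 165118; 165300; 165302; 165362;
   165428; 165430; 165490; 165693; 165695; 165758; 165876; 165878; 166388;
   166390; 166516; 166518; 167132; 167134; 167772; 167774; 168604; 168606;
   168848; 168850; 169150; 169394; 169522; 169661; 169663; 169726; 169790;
   169908; 169910; 169970; 170173; 170175; 170238; 170420; 170422; 170482;
   170548; 170550; 170610; 170749; 170751; 170813; 170815; 170878; 170996;
   170998; 171164; 171166; 171408; 171410; 171536; 171538; 171740; 171742;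
   171804; 171806; 171984; 171986; 181748; 181750; 181876; 181878; 185052;
   185054; 185533; 185535; 185780; 185782; 185908; 185910; 186173; 186175;
   186356; 186358; 186621; 186623; 186868; 186870; 186996; 186998; 187261;
   187263; 187612; 187614; 187856; 187858; 187984; 187986; 188252; 188254;
   197886; 198128; 198130; 198258; 198526; 200416; 200684; 201918; 202162;
   202290; 202494; 202558; 202736; 202738; 203006; 203250; 203378; 203646;
   204448; 204716; 204776; 220896; 221164; 230902; 231030; 233188; 234206;
   234687; 234934; 235062; 235325; 235327; 235508; 235510; 235773; 235775;
   236022; 236150; 236413; 236415; 236766; 237010; 237138; 237220; 237280;
   237404; 237406; 237485; 237548; 253668; 253933]%positive);
  (Neg 2,
   [161452; 161696; 194221; 194468; 201640; 202536; 202538; 204200; 204328;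
   210848; 226476; 226478; 226720; 226722; 226848; 226850; 227052; 227054;
   227116; 227118; 227296; 227298; 234144; 234412; 234670; 234912; 234914;
   235040; 235042; 235244; 235246; 235308; 235310; 235488; 235490; 236704;
   236972; 237100; 237344; 243373; 243620; 259245; 259247; 259492; 259494;
   259620; 259622; 259885; 259887; 260068; 260070]%positive);
  (Neg 3,
   [158572; 192332; 203624; 203626; 207724; 223084; 223086; 223596; 223598;
   228204; 228206; 230380; 231276; 231278; 231788; 231790; 232940; 233068;
   233312; 236396; 236398; 241484; 254796; 254798; 257356; 257358; 260973;
   260975; 261964; 261966]%positive);
  (Neg 4,
   [156207; 156390; 156454; 157070; 157198; 157646; 158158; 158767; 158950;
   159014; 159590; 160422; 160687; 161410; 161678; 162190; 162318; 162498;
   162766; 162982; 163247; 163375; 163558; 163622; 163823; 163996; 163998;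
   164368; 164370; 165940; 165942; 166928; 166930; 189223; 189574; 190150;
   190214; 190662; 190726; 191302; 191719; 191783; 192359; 193191; 194182;
   194694; 195270; 195334; 195751; 196327; 196391; 198564; 198829; 199076;
   199204; 199469; 199652; 200064; 200192; 203437; 203684; 204672; 210830;
   230276; 231973; 241511]%positive);
  (Neg 7,
   [201392; 201660; 202802; 203952; 204220; 204348; 204528; 204592; 204796;
   233630; 233874; 234002; 234164; 235152; 235574; 235664; 235932; 236060;
   236240; 236304; 236508; 236562; 236724; 237300; 237364]%positive);
  (Neg 8,
   [133436; 133438; 137530; 149884; 149886; 153916; 153918; 164636; 164638;
   166205; 166207; 166270; 167196; 167198; 170302; 181084; 181086; 183644;
   183646; 185116; 185118; 186685; 186687; 187676; 187678; 199038; 203070;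
   230238; 232396; 232796; 232798; 234270; 235837; 235839; 236428; 236830;
   252876]%positive);
  (Neg 10,
   [146674; 146738; 147314; 199740; 199984; 202429; 202431; 202676; 202678;
   206260; 206262; 206388; 206390; 206653; 206655; 206836; 206838; 211133;
   211135; 211380; 211382; 211508; 211510; 211709; 211711; 211773; 211775;
   211956; 211958; 212124; 212368; 212370; 212496; 212498; 212700; 212764;
   212944; 212946; 232756; 239157; 239159; 244277; 244279; 245140; 245268;
   245716]%positive);
  (Neg 11,
   [148958; 149086; 152310; 152990; 153118; 153566; 154078; 154206; 154870;
   155135; 155263; 155510; 169950; 178142; 180446; 181462; 182102; 184478;
   185079; 185494; 185822; 185950; 186070; 186134; 186582; 187222; 187639;
   188279; 194014; 194142; 202718; 210910]%positive);
  (Neg 12,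
   [193164]%positive);
  (Neg 14,
   [184140; 196300; 196364; 197548; 199840; 200108; 200236; 200396; 200460;
   200480; 230052; 231308; 231333; 231820; 231845; 231948; 232192; 232421;
   232612; 232654; 232718; 232836; 232877; 232964; 233005; 233252; 233294;
   233412; 236160; 236453; 237262; 237326; 237444; 245452; 245516;
   247756]%positive);
  (Neg 18,
   [218860; 219104; 219106; 251876]%positive);
  (Neg 20,
   [183500; 183564; 187532; 188108; 188172; 191692; 191756; 195724]%positive);
  (Neg 22,
   [197360; 197628; 199920; 200188; 200316; 200560; 229598; 230132; 231388;
   231542; 231900; 232028; 232692]%positive);
  (Neg 28,
   [146494; 146942; 147070; 173086; 173534; 173662; 177566; 177694; 178206;
   178654; 178782; 179263; 179446; 179510; 179711; 179839; 180086]%positive);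
  (Neg 29,
   [139774; 144382; 197052; 200540; 205532; 205534; 205596; 205598; 207165;
   207167; 207348; 207350; 208092; 208156; 230812; 238548; 238550;
   241108]%positive);
  (Neg 32,
   [132410; 164914; 165182; 166002; 170034; 199720; 229536; 229804; 229932;
   230112; 230176; 232492; 232672; 232736]%positive);
  (Neg 35,
   [220012; 220014; 252781; 253772]%positive);
  (Neg 39,
   [193566; 193934; 194062; 194510; 243086; 243662; 258190; 258766; 258830;
   261326; 261390]%positive);
  (Neg 44,
   [154450; 181111; 183671; 185143; 187703; 237431; 245623]%positive);
  (Neg 48,
   [251788]%positive);
  (Neg 52,
   [186318; 218862; 250574; 251878; 253134; 253774]%positive);
  (Neg 56,
   [153810; 219885; 220132; 252608; 252901; 253892]%positive);
  (Neg 61,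
   [192357; 257381; 257383; 261989; 261991]%positive);
  (Neg 65,
   [197280; 235183; 235430]%positive);
  (Neg 66,
   [249166; 253198]%positive);
  (Neg 78,
   [247781; 251813]%positive);
  (Neg 79,
   [161663; 194535]%positive);
  (Neg 103,
   [216908]%positive);
  (Neg 107,
   [252783]%positive);
  (Neg 108,
   [178167]%positive);
  (Cut 2 (Neg 9),
   [220320; 220588; 220716; 220960; 253092; 253357; 253485; 253732]%positive);
  (Cut 7 (Odd 6),
   [153650; 184722; 184850; 186422; 187410]%positive);
  (Cut 20 (Odd 6),
   [148652; 149292; 149740; 149804; 150380; 153772; 180940; 181004; 181796;
   182308; 182884; 183296; 184972; 186916; 187904; 190500; 191488]%positive);
  (Cut 24 (Odd 6),
   [148896; 149472; 149984; 153504; 154016; 181668; 182061; 182244; 182573;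
   182756; 185216; 186029; 186276; 186541; 186788; 187181; 187776]%positive);
  (Cut 3 (Neg 25),
   [213996; 216556; 248268]%positive);
  (Cut 11 (Odd 40),
   [152062; 184566; 184959; 185206; 186194; 187519; 187766]%positive);
  (Cut 22 (Odd 75),
   [149618; 182390]%positive);
  (Cut 44 (Odd 55),
   [154994; 186706]%positive);
  (Cut 4 (Cut 5 (Odd 6)),
   [149024; 150112; 154144; 180736]%positive);
  (Cut 0 (Cut 1 (Odd 40)),
   [213728; 216288; 246500; 249060]%positive);
  (Cut 0 (Cut 4 (Neg 15)),
   [147519; 147702; 147766; 148342; 148754; 150902; 151999; 152127; 152374;
   153362; 153874; 154687; 154934; 180471; 180535; 181526; 186646; 213420;
   213548; 213792; 214436; 216108; 216352; 245924; 246317; 246564; 247180;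
   247205; 247308; 247552; 247820; 248064; 248877; 249124; 252032]%positive);
  (Cut 0 (Cut 8 (Odd 55)),
   [252300; 252428; 252672]%positive);
  (Cut 12 (Cut 5 (Odd 6)),
   [258188; 258434; 258562; 260134; 261122]%positive);
  (Cut 2 (Cut 0 (Neg 42)),
   [161964; 162208; 162336; 193408; 194733; 194980; 195108; 195968;
   196096]%positive);
  (Cut 2 (Cut 0 (Odd 27)),
   [156844; 157088; 157216; 189860; 189988]%positive);
  (Cut 2 (Cut 3 (Odd 38)),
   [157420; 157484; 157664; 162540; 162604; 162784; 190253; 190436; 195309;
   195373; 195556; 196544]%positive);
  (Cut 2 (Cut 9 (Neg 34)),
   [227564; 227808; 227936; 260333; 260580; 260708; 261568; 261696]%positive);
  (Cut 3 (Cut 0 (Neg 53)),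
   [157932; 158176; 158304; 189132; 190948; 191076]%positive);
  (Cut 3 (Cut 0 (Odd 30)),
   [139902; 140146; 157996; 172918; 179026; 189196; 190765]%positive);
  (Cut 41 (Cut 5 (Odd 6)),
   [223330; 256102]%positive);
  (Cut 7 (Cut 0 (Neg 62)),
   [148798; 180510; 181302; 181567]%positive);
  (Cut 7 (Cut 0 (Odd 23)),
   [148528; 148530; 148796; 153648; 178386; 178450; 180240; 180242; 180444;
   180508; 181300; 181565; 182388; 184720; 184848; 186420; 187408]%positive);
  (Cut 22 (Cut 0 (Odd 23)),
   [172278]%positive);
  (Cut 24 (Cut 32 (Odd 6)),
   [188928]%positive);
  (Cut 7 (Cut 22 (Odd 57)),
   [197682; 197950; 229394; 229662; 230454; 230719]%positive);
  (Cut 2 (Cut 7 (Cut 0 (Odd 30))),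
   [143934; 144178; 176310; 176703; 176950; 177298; 177938]%positive);
  (Cut 2 (Cut 9 (Cut 34 (Odd 6))),
   [222240; 222242; 227360; 227362; 255012; 255014; 260132; 261120]%positive);
  (Cut 2 (Cut 12 (Cut 24 (Odd 6))),
   [153260]%positive);
  (Cut 2 (Cut 12 (Cut 9 (Neg 33))),
   [218286; 218926; 222446; 251055; 251302; 251430]%positive);
  (Cut 2 (Cut 18 (Cut 0 (Odd 31))),
   [217760; 218028; 250532; 250797; 251520]%positive);
  (Cut 2 (Cut 7 (Cut 29 (Odd 23))),
   [143806; 176575]%positive);
  (Cut 2 (Cut 9 (Cut 19 (Neg 33))),
   [218528; 218530; 218656; 218658; 218924; 222816; 251053; 251300; 251428;
   251693; 255588]%positive);
  (Cut 3 (Cut 18 (Cut 0 (Odd 64))),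
   [216684; 216928; 249700]%positive);
  (Cut 3 (Cut 35 (Cut 0 (Odd 64))),
   [248396]%positive);
  (Cut 51 (Cut 48 (Cut 5 (Odd 6))),
   [251695; 252143; 252390; 252518; 253378; 253506]%positive);
  (Cut 7 (Cut 22 (Cut 0 (Odd 23))),
   [172095]%positive);
  (Cut 12 (Cut 5 (Cut 26 (Odd 13))),
   [258432; 258560]%positive);
  (Cut 3 (Cut 22 (Cut 10 (Odd 23))),
   [142462; 142706; 175478]%positive);
  (Cut 3 (Cut 25 (Cut 17 (Neg 49))),
   [214892; 214894; 215404; 215406; 246604; 246606; 249164]%positive);
  (Cut 3 (Cut 5 (Cut 25 (Cut 47 (Odd 6)))),
   [254156; 254158; 254220; 254222]%positive);
  (Cut 3 (Cut 5 (Cut 45 (Cut 46 (Odd 6)))),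
   [202984; 235756; 235758; 236000; 236128]%positive);
  (Cut 1 (Cut 5 (Cut 21 (Cut 84 (Neg 91)))),
   [231008]%positive);
  (Cut 18 (Cut 4 (Cut 41 (Cut 24 (Odd 6)))),
   [149228]%positive);
  (Cut 2 (Cut 3 (Cut 18 (Cut 12 (Odd 27)))),
   [227566; 258764; 260335; 260582; 260710; 261324; 261570; 261698]%positive);
  (Cut 2 (Cut 3 (Cut 18 (Cut 41 (Odd 30)))),
   [222690; 222818; 227810; 227938; 255462; 255590]%positive);
  (Cut 2 (Cut 3 (Cut 35 (Cut 12 (Odd 27)))),
   [227630; 258828; 260399; 261388]%positive);
  (Cut 2 (Cut 5 (Cut 83 (Cut 87 (Neg 47)))),
   [230432]%positive);
  (Cut 8 (Cut 12 (Cut 5 (Cut 26 (Odd 13)))),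
   [250638]%positive);
  (Cut 12 (Cut 11 (Cut 5 (Cut 26 (Odd 13)))),
   [249998]%positive);
  (Cut 18 (Cut 35 (Cut 1 (Cut 12 (Odd 27)))),
   [154348; 154592; 187117; 187364; 188352]%positive);
  (Cut 35 (Cut 8 (Cut 4 (Cut 24 (Odd 101)))),
   [154412]%positive);
  (Cut 2 (Cut 3 (Cut 5 (Cut 9 (Cut 25 (Odd 6))))),
   [222444; 222508; 222510; 222688; 227628; 255277; 255279; 255460;
   260397]%positive);
  (Cut 1 (Cut 8 (Cut 5 (Cut 50 (Cut 59 (Neg 70))))),
   [247085]%positive);
  (Cut 0 (Cut 5 (Cut 16 (Cut 19 (Cut 26 (Odd 13))))),
   [223328; 253952; 253954; 256100]%positive);
  (Cut 0 (Cut 69 (Cut 59 (Cut 37 (Cut 89 (Odd 6))))),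
   [245762]%positive);
  (Cut 1 (Cut 5 (Cut 16 (Cut 21 (Cut 17 (Odd 31))))),
   [219372; 219374; 219616; 219618; 219744; 219746; 250572; 252141; 252388;
   252516; 253132; 253376; 253504]%positive);
  (Cut 1 (Cut 5 (Cut 21 (Cut 17 (Cut 36 (Odd 13))))),
   [214252; 214254; 214496; 214498; 214624; 214626; 247268; 247270; 247396;
   247398]%positive);
  (Cut 4 (Cut 5 (Cut 16 (Cut 19 (Cut 26 (Odd 13))))),
   [219170; 250242; 250370; 251942; 252930]%positive);
  (Cut 4 (Cut 5 (Cut 21 (Cut 17 (Cut 36 (Odd 13))))),
   [245966; 247910]%positive);
  (Cut 8 (Cut 5 (Cut 16 (Cut 19 (Cut 26 (Odd 13))))),
   [219436; 219438; 250636; 252205; 252207; 253196]%positive);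
  (Cut 32 (Cut 5 (Cut 16 (Cut 82 (Cut 94 (Neg 47))))),
   [235552]%positive);
  (Cut 2 (Cut 3 (Cut 1 (Cut 5 (Cut 45 (Cut 68 (Odd 6)))))),
   [230636; 230638; 230880]%positive);
  (Cut 2 (Cut 3 (Cut 8 (Cut 5 (Cut 46 (Cut 67 (Odd 6)))))),
   [203048; 235820]%positive);
  (Cut 0 (Cut 5 (Cut 73 (Cut 37 (Cut 58 (Cut 54 (Odd 6)))))),
   [246028; 246820]%positive);
  (Cut 1 (Cut 5 (Cut 72 (Cut 16 (Cut 19 (Cut 26 (Odd 13)))))),
   [219168; 252928]%positive);
  (Cut 8 (Cut 24 (Cut 28 (Cut 37 (Cut 50 (Cut 54 (Odd 6)))))),
   [247087]%positive);
  (Cut 0 (Cut 69 (Cut 59 (Cut 37 (Cut 90 (Cut 88 (Neg 47)))))),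
   [214050]%positive);
  (Cut 2 (Cut 3 (Cut 7 (Cut 1 (Cut 5 (Cut 46 (Cut 67 (Odd 6))))))),
   [235822]%positive);
  (Cut 1 (Cut 8 (Cut 5 (Cut 43 (Cut 37 (Cut 58 (Cut 54 (Odd 6))))))),
   [214316]%positive);
  (Cut 3 (Cut 1 (Cut 5 (Cut 43 (Cut 37 (Cut 58 (Cut 54 (Odd 6))))))),
   [230700]%positive);
  (Cut 2 (Cut 3 (Cut 32 (Cut 5 (Cut 16 (Cut 109 (Cut 81 (Neg 26))))))),
   [197928]%positive);
  (Cut 20 (Cut 66 (Cut 37 (Cut 43 (Cut 50 (Cut 63 (Cut 60 (Odd 6))))))),
   [246822]%positive);
  (Cut 1 (Cut 8 (Cut 5 (Cut 43 (Cut 86 (Cut 16 (Cut 19 (Cut 26 (Odd 13)))))))),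
   [251940]%positive);
  (Cut 3 (Cut 20 (Cut 28 (Cut 37 (Cut 43 (Cut 50 (Cut 63 (Cut 60 (Odd
  6)))))))),
   [230702]%positive);
  (Cut 8 (Cut 20 (Cut 28 (Cut 37 (Cut 43 (Cut 50 (Cut 63 (Cut 60 (Odd
  6)))))))),
   [214318; 246030]%positive);
  (Cut 1 (Cut 8 (Cut 5 (Cut 43 (Cut 37 (Cut 58 (Cut 21 (Cut 17 (Cut 36 (Odd
  13))))))))),
   [245964; 247908]%positive);
  (Cut 5 (Cut 71 (Branch (0, 1, 2)%nat (Cut 59 (Cut 70 (Cut 60 (Odd 6)))) (Cut
  69 (Cut 106 (Cut 37 (Cut 54 (Odd 6))))))),
   [245760]%positive);
  (Cut 1 (Cut 5 (Cut 71 (Cut 98 (Cut 99 (Cut 104 (Branch (28, 23, 16)%nat (Cut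
  96 (Odd 13)) (Cut 97 (Cut 95 (Neg 47))))))))),
   [214048]%positive);
  (Cut 1 (Cut 8 (Cut 12 (Cut 5 (Cut 80 (Cut 76 (Cut 77 (Branch (12, 11, 10)%nat
  (Cut 105 (Cut 92 (Cut 93 (Odd 102)))) (Cut 8 (Cut 12 (Odd 74)))))))))),
   [250368]%positive);
  (Cut 1 (Cut 8 (Cut 12 (Cut 24 (Cut 5 (Cut 80 (Cut 76 (Cut 77 (Branch (0, 3,
  8)%nat (Cut 100 (Cut 85 (Odd 55))) (Cut 50 (Cut 59 (Cut 70 (Cut 16 (Cut 19
  (Odd 74)))))))))))))),
   [250240]%positive)
].

(** * The enumeration *)

(* Only the residues 0 and 1 of x + y (resp. x - y) modulo 3 are counted: a
   jump meets each residue once, so it changes the count by an even number. *)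
Definition parity_vectors : list (list Z) := Eval compute in
  [map (fun c => if (fst c + snd c) mod 3 =? 2 then 0 else 1) cells;
   map (fun c => if (fst c - snd c) mod 3 =? 2 then 0 else 1) cells].

Definition parities : list (list Z * bool) := Eval compute in
  map (fun q => (fold_weights q, Z.odd (dot q (enc start_pos)))) parity_vectors.

Definition parity_fails (s : list bool) : bool :=
  existsb (fun r => xorb (Z.odd (dot (fst r) s)) (snd r)) parities.

(** Some first move certainly occurs, so any play with at least one jump loses this much by that
    jump. Folding from an actual loss avoids an artificial starting value for the minimum. *)
Definition least_loss (q : list Z) : Z :=
  match map (loss q) first_moves with
  | [] => 0
  | l :: ls => fold_right Z.min l ls
  end.

(* Folded weights, the largest value they may take after the first jump, and
   their value on the full board. *)
Definition root (w : list Z) : list Z * Z * Z :=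
  let q := unfold_half w in
  (fold_weights q, dot q (enc start_pos) - least_loss q, dot q (repeat true 33)).

Definition roots : list (list Z * Z * Z) := Eval vm_compute in
  map root root_weights.

(** The number [full - v] is the weight of the complementary position, which has to obey the same
    bound. *)
Definition root_fails (s : list bool) : bool :=
  existsb (fun r => let '(w, bound, full) := r in
    let v := dot w s in (bound <? v) || (bound <? full - v)) roots.

Definition excluded : PositiveSet.t := Eval vm_compute in
  fold_right PositiveSet.add PositiveSet.empty (concat (map snd table)).

(** Since [opening] is symmetric under [flip], it reaches a position exactly when it reaches the
    mirror image; the table needs only one of the two. *)
Definition blocked (s : list bool) : bool :=
  PositiveSet.mem (key s) excluded ||
  PositiveSet.mem (key (permute flip_order s)) excluded.

(** Up to rotation there are two first jumps. The second is dealt with by transposing the target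
    instead of the opening. *)
Definition unreachable (s : list bool) : bool :=
  blocked s && blocked (permute transpose_order s).

(** With an empty centre, the first case is the start position itself. The last two tests ask for
    the position or its complement to be unreachable. Nested conditionals keep the later tests from
    being evaluated by [vm_compute] once an earlier one has succeeded. *)
Definition handled (s : list bool) : bool :=
  if forallb id (firstn 16 s) then true
  else if parity_fails s then true
  else if root_fails s then true
  else if unreachable s then true
  else unreachable (map negb s).

(** * Evaluation of the checks and their soundness *)

Lemma table_correct :
  forallb (fun e => forallb (fun p =>
    refutes vectors (enc opening) (fst e) moves [] (unfold_half (bits p)))
    (snd e)) table = true.
Proof. vm_compute; reflexivity. Qed.

Lemma all_handled : all_lists 16 (fun l => handled (l ++ [false])) = true.
Proof. vm_compute; reflexivity. Qed.

Lemma parities_even :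
  forallb (fun q => forallb (fun m => Z.even (loss q m)) moves) parity_vectors
  = true.
Proof. reflexivity. Qed.

Lemma roots_nonneg :
  forallb (fun w => (length w =? 17)%nat &&
    forallb (fun m => 0 <=? loss (unfold_half w) m) moves) root_weights = true.
Proof. reflexivity. Qed.

Lemma excluded_in_table p : PositiveSet.mem p excluded = true ->
  exists e, In e table /\ In p (snd e).
Proof.
  intros H.
  assert (E : excluded =
    fold_right PositiveSet.add PositiveSet.empty (concat (map snd table)))
    by (vm_compute; reflexivity).
  rewrite E in H; clear E.
  assert (I : In p (concat (map snd table))).
  { induction (concat (map snd table)) as [| k l IH]; simpl in H.
    - destruct p; discriminate H.
    - rewrite PositiveSet.mem_spec, PositiveSet.add_spec in H.
      destruct H as [-> | H]; [now left |].
      right; apply IH; now rewrite PositiveSet.mem_spec. }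
  apply in_concat in I as (l & Hl & Hp); apply in_map_iff in Hl as (e & <- & He).
  exists e; split; assumption.
Qed.

(** The moves of a play from [opening] to [t] would solve the displacement equations that the
    certificate stored with the key of [t] refutes, starting with all moves allowed and none known
    to occur. *)
Lemma excluded_sound t : rot180_invariant t ->
  PositiveSet.mem (key (half t)) excluded = true -> ~ play opening t.
Proof.
  intros R H P; apply excluded_in_table in H as (e & He & Hp).
  pose proof table_correct as T; rewrite forallb_forall in T.
  specialize (T e He); rewrite forallb_forall in T; specialize (T _ Hp).
  rewrite bits_key, <- enc_half in T by exact R.
  destruct (play_losses _ _ P) as (ms & Hms & Hq).
  refine (refutes_sound _ _ _ _ _ _ T ms Hms _).
  intros q; unfold displacement; rewrite Hq; simpl; lia.
Qed.

Lemma blocked_sound t : rot180_invariant t ->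
  blocked (half t) = true -> ~ play opening t.
Proof.
  intros R H P; apply orb_true_iff in H as [H | H].
  - exact (excluded_sound t R H P).
  - rewrite <- half_flip in H by exact R.
    apply (excluded_sound (flip t) (flip_invariant t R) H).
    apply (play_ext _ (flip opening)); [| now apply play_flip].
    intros x y; unfold flip, opening.
    rewrite !opp_eqb; unfold inH; now rewrite Z.abs_opp.
Qed.

Lemma unreachable_sound t : rot180_invariant t ->
  unreachable (half t) = true -> play start_pos t -> pos_eq t start_pos.
Proof.
  intros R H P; apply andb_true_iff in H as [H1 H2].
  rewrite <- half_transpose in H2 by exact R.
  destruct (play_start t R P) as [E | [P' | P']]; [exact E | |]; exfalso.
  - exact (blocked_sound t R H1 P').
  - exact (blocked_sound _ (transpose_invariant t R) H2 P').
Qed.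

Lemma parity_sound t : rot180_invariant t -> play start_pos t ->
  parity_fails (half t) = false.
Proof.
  intros R P; apply not_true_iff_false; intros H.
  apply existsb_exists in H as (r & Hr & H).
  change parities with
    (map (fun q => (fold_weights q, Z.odd (dot q (enc start_pos)))) parity_vectors)
    in Hr.
  apply in_map_iff in Hr as (q & <- & Hq); cbn [fst snd] in H.
  assert (Lq : length q = 33%nat)
    by (destruct Hq as [<- | [<- | []]]; reflexivity).
  rewrite <- dot_fold_weights, <- enc_half in H
    by first [exact R | exact Lq | apply half_length].
  pose proof parities_even as T; rewrite forallb_forall in T; specialize (T q Hq).
  destruct (play_losses _ _ P) as (ms & Hms & Ht).
  pose proof (total_even _ _ _ T Hms) as Ev.
  rewrite Ht, Z.odd_add, <- (Z.negb_even (total q ms)), Ev in H.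
  destruct (Z.odd (dot q (enc t))); discriminate H.
Qed.

Lemma least_loss_le q m : In m first_moves -> least_loss q <= loss q m.
Proof.
  intros H; apply (in_map (loss q)) in H; unfold least_loss.
  destruct (map (loss q) first_moves) as [| l ls]; [destruct H |].
  assert (G : fold_right Z.min l ls <= l /\
              forall x, In x ls -> fold_right Z.min l ls <= x).
  { clear H; induction ls as [| a ls [IH1 IH2]]; simpl.
    - split; [lia | intros x []].
    - split; [lia | intros x [-> | Hx]; [lia |]].
      specialize (IH2 x Hx); lia. }
  destruct G as [G1 G2], H as [<- | H]; [exact G1 | exact (G2 _ H)].
Qed.

(** The first jump loses at least [least_loss q] and the later ones lose nothing negative. The start
    position must be left out, as it is reached without any jump. *)
Lemma root_bound q t :
  forallb (fun m => 0 <=? loss q m) moves = true ->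
  play start_pos t -> ~ pos_eq t start_pos ->
  dot q (enc t) <= dot q (enc start_pos) - least_loss q.
Proof.
  intros V P N.
  destruct (play_start_losses t P) as [E | (m & ms & Hm & Hms & Hq)];
    [contradiction |].
  pose proof (total_nonneg _ _ _ V Hms); pose proof (least_loss_le q m Hm).
  rewrite Hq; lia.
Qed.

Lemma root_sound t u : rot180_invariant t -> enc u = map negb (enc t) ->
  play start_pos t -> play start_pos u ->
  ~ pos_eq t start_pos -> ~ pos_eq u start_pos -> root_fails (half t) = false.
Proof.
  intros R E Pt Pu Nt Nu; apply not_true_iff_false; intros H.
  apply existsb_exists in H as (r & Hr & H).
  assert (ER : roots = map root root_weights) by (vm_compute; reflexivity).
  rewrite ER in Hr; apply in_map_iff in Hr as (w & <- & Hw); clear ER.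
  pose proof roots_nonneg as T; rewrite forallb_forall in T.
  specialize (T w Hw); apply andb_true_iff in T as [L T]; apply Nat.eqb_eq in L.
  unfold root in H; set (q := unfold_half w) in *.
  assert (Lq : length q = 33%nat).
  { unfold q, unfold_half.
    rewrite length_app, length_rev, length_firstn, L; reflexivity. }
  rewrite <- dot_fold_weights, <- enc_half in H
    by first [exact R | exact Lq | apply half_length].
  pose proof (root_bound q t T Pt Nt) as Bt.
  pose proof (root_bound q u T Pu Nu) as Bu.
  rewrite E, dot_negb in Bu.
  change (length (enc t)) with 33%nat in Bu.
  apply orb_true_iff in H as [H | H]; apply Z.ltb_lt in H; lia.
Qed.

(** Here [t] is whichever of an invariant position and its complement has an empty centre. They are
    related only by their codes, so that either can play the role of [t]: complementing twice
    restores a position on the board, but not necessarily off it. *)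
Lemma pair_is_start t u :
  rot180_invariant t -> rot180_invariant u -> enc u = map negb (enc t) ->
  t 0 0 = false -> play start_pos t -> play start_pos u ->
  enc t = enc start_pos.
Proof.
  intros Rt Ru E C Pt Pu.
  assert (Hu : half u = map negb (half t)).
  { change (half u) with (firstn 17 (enc u)); rewrite E.
    now rewrite firstn_map. }
  (* The centre of [u] is filled, whereas that of the start is empty. *)
  assert (Nu : ~ pos_eq u start_pos).
  { intros S; assert (Hc : nth 16 (half u) false = negb (nth 16 (half t) true))
      by (rewrite Hu; reflexivity).
    change (u 0 0 = negb (t 0 0)) in Hc.
    rewrite C, S in Hc; discriminate Hc. }
  assert (Ht : half t = firstn 16 (half t) ++ [false])
    by (rewrite <- C; reflexivity).
  assert (S : half t = half start_pos -> enc t = enc start_pos).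
  { intros H; rewrite (enc_half t Rt), H; reflexivity. }
  pose proof (all_lists_spec 16 _ all_handled (firstn 16 (half t)) eq_refl) as H.
  cbv beta in H; rewrite <- Ht in H; unfold handled in H.
  destruct (forallb id (firstn 16 (half t))) eqn:F;
    [clear H | rewrite (parity_sound t Rt Pt) in H;
     destruct (root_fails (half t)) eqn:G;
     [clear H | destruct (unreachable (half t)) eqn:K; [clear H |]]].
  - rename F into H; apply S; rewrite Ht; rewrite forallb_forall in H.
    assert (A : forall l, (forall x, In x l -> id x = true) ->
              l = repeat true (length l)).
    { induction l as [| x l IH]; intros G; [reflexivity |].
      simpl; rewrite <- IH by (intros y Hy; apply G; now right).
      f_equal; apply (G x); now left. }
    rewrite (A _ H); reflexivity.
  (* Equality with the start is not decidable for arbitrary functions, but the play decides it: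
     either it has no jump, or it has one and then, by the all-ones weight, [t] has fewer pegs than
     the start. *)
  - assert (D : pos_eq t start_pos \/ ~ pos_eq t start_pos).
    { destruct (play_start_losses t Pt) as [D | (m & ms & Hm & Hms & Hq)];
        [now left | right; intros D].
      specialize (Hq (repeat 1 33)); rewrite (enc_ext _ _ D) in Hq.
      pose proof (least_loss_le (repeat 1 33) m Hm) as B.
      assert (0 <= total (repeat 1 33) ms)
        by (refine (total_nonneg _ moves _ _ Hms); reflexivity).
      change (least_loss (repeat 1 33)) with 1 in B; lia. }
    destruct D as [D | D]; [now apply enc_ext |].
    rewrite (root_sound t u Rt E Pt Pu D Nu) in G; discriminate G.
  - apply enc_ext, (unreachable_sound t Rt K Pt).
  (* In the last case it is [u] that cannot be reached unless it is the start, which its filled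
     centre forbids. *)
  - rewrite <- Hu in H; exfalso; apply Nu.
    exact (unreachable_sound u Ru H Pu).
Qed.

(** * Solutions *)

Definition pegs (b : Position) : Z := dot (repeat 1 33) (enc b).

(** Under the all-ones weight each move loses 1 + 1 - 1. *)
Lemma jump_pegs b c : jump b c -> pegs c = pegs b - 1.
Proof.
  intros J; destruct (jump_loss b c J) as (m & Hm & _ & Hq).
  assert (L : forallb (fun m => loss (repeat 1 33) m =? 1) moves = true)
    by reflexivity.
  rewrite forallb_forall in L; specialize (L m Hm); apply Z.eqb_eq in L.
  unfold pegs; rewrite Hq; lia.
Qed.

Lemma enc_complement b : enc (complement b) = map negb (enc b).
Proof.
  unfold enc; rewrite map_map; apply map_ext_in; intros [x y] H.
  unfold at_cell, complement; simpl fst; simpl snd.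
  assert (I : forallb (fun c => inH (fst c) (snd c)) cells = true) by reflexivity.
  rewrite forallb_forall in I; specialize (I _ H); simpl in I.
  now rewrite I.
Qed.

Lemma start_pegs : pegs start_pos = 32.
Proof. reflexivity. Qed.

Lemma pegs_enc b c : enc b = enc c -> pegs b = pegs c.
Proof. unfold pegs; now intros ->. Qed.

Lemma complement_pegs b : pegs (complement b) = 33 - pegs b.
Proof.
  unfold pegs; rewrite enc_complement, dot_negb.
  unfold enc at 1; rewrite length_map; reflexivity.
Qed.

Lemma complement_invariant b :
  rot180_invariant b -> rot180_invariant (complement b).
Proof. intros R x y; unfold complement; now rewrite inH_opp, R. Qed.

(* Any solution b 0, ..., b n of the central game: no intermediate
   position b i (0 < i < n) is invariant under the 180-degree rotation. *)
Theorem theorem2 (b : nat -> Position) (n : nat)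
  (Hstart : pos_eq (b 0%nat) start_pos)
  (Hfinal : pos_eq (b n) final_pos)
  (Hjump : forall i : nat, (i < n)%nat -> jump (b i) (b (S i))) :
  forall i : nat, (0 < i)%nat -> (i < n)%nat -> ~ rot180_invariant (b i).
Proof.
  intros i H0 Hi R.
  (* The peg count dates each position. Together with the single final peg it forces [n = 31], which
     separates intermediate positions from both ends. *)
  assert (Hpegs : forall k, (k <= n)%nat -> pegs (b k) = 32 - Z.of_nat k).
  { induction k as [| k IH]; intros Hk.
    - rewrite (pegs_enc _ _ (enc_ext _ _ Hstart)); apply start_pegs.
    - rewrite (jump_pegs _ _ (Hjump k Hk)), IH by lia; lia. }
  assert (Pf : forall k, (k <= n)%nat -> play start_pos (b k)).
  { induction k as [| k IH]; intros Hk.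
    - apply play_refl; intros x y; symmetry; apply Hstart.
    - apply (play_snoc _ (b k)); [apply IH; lia | now apply Hjump]. }
  (* The solution is read backwards through complements: the complement of the final position is the
     start, and every undone jump becomes a jump. *)
  assert (Pb : forall k, (k <= n)%nat -> play start_pos (complement (b (n - k)%nat))).
  { induction k as [| k IH]; intros Hk.
    - rewrite Nat.sub_0_r; apply play_refl; intros x y.
      unfold complement, start_pos; now rewrite Hfinal.
    - apply (play_snoc _ (complement (b (n - k)%nat))); [apply IH; lia |].
      apply jump_complement.
      replace (n - k)%nat with (S (n - S k)) by lia.
      apply Hjump; lia. }
  assert (Pi := Pf i (Nat.lt_le_incl _ _ Hi)).
  assert (Pc : play start_pos (complement (b i))).
  { replace i with (n - (n - i))%nat by lia; apply Pb; lia. }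
  assert (Rc := complement_invariant _ R).
  assert (Ec := enc_complement (b i)).
  assert (Hn := Hpegs n (le_n n)).
  assert (En : pegs (b n) = 1) by (now rewrite (pegs_enc _ _ (enc_ext _ _ Hfinal))).
  assert (Hk := Hpegs i (Nat.lt_le_incl _ _ Hi)).
  (* Exactly one of [b i] and its complement has an empty centre; that one must have the code of the
     start. *)
  destruct (b i 0 0) eqn:C.
  - assert (E : enc (complement (b i)) = enc start_pos).
    { apply (pair_is_start _ (b i)); try assumption.
      - rewrite Ec, map_map, <- (map_id (enc (b i))) at 1.
        apply map_ext; intros []; reflexivity.
      - unfold complement; now rewrite C. }
    (* The complement has [i + 1] pegs, so 32 pegs would mean [i = 31 = n]. *)
    apply pegs_enc in E; rewrite complement_pegs, start_pegs in E; lia.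
  - assert (E : enc (b i) = enc start_pos)
      by (apply (pair_is_start _ (complement (b i))); assumption).
    (* Here [b i] itself would have 32 pegs, that is, [i = 0]. *)
    apply pegs_enc in E; rewrite start_pegs in E; lia.
Qed.
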